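(* Let $M$ be an $R$-module, $(t_n)_{n\ge1}$ a Markov trace on $(\widetilde{BMW}_n)_{n\ge1}$ with values in $M$, let $S^{\dagger}=S/(a^2-y)$, $N=M\otimes_R S^{\dagger}[(y-1)^{-1}]$, and let $t'_n$ be the composite of $t_n$ with the natural map $M\to N$. Then $(t'_n)$ is a scalar multiple of the Ocneanu trace: there exists $m\in N$ such that $t'_n(\beta)=t_n^H(\beta)\,m$ for all $n\ge1$ and all $\beta\in\widetilde{BMW}_n$.
   Context: $R=\mathbb{Q}[a,b,c,(abc)^{-1}]$, $x=b+c$, $y=bc$, $S=R[x^{-1}]$. $H_n$ is the quotient of the group algebra $RB_n$ of the braid group (Artin generators $s_1,\dots,s_{n-1}$) by the relations $(s_i-a)(s_i-b)(s_i-c)=0$. $\widetilde{BMW}_n$ is the quotient of $H_n$ by the two-sided ideal generated by $$\mathcal{R}_i=-y\,s_is_{i+1}^{-1}s_i+y^2s_{i+1}^{-1}s_is_{i+1}^{-1}-s_is_{i+1}s_i-xy^2s_{i+1}^{-2}+x\,s_i^2+y^3s_{i+1}^{-1}s_i^{-1}s_{i+1}^{-1},\quad 1\le i\le n-2.$$ A Markov trace on $(\widetilde{BMW}_n)_{n\ge1}$ with values in an $R$-module $M$ is a sequence of $R$-linear maps $t_n:\widetilde{BMW}_n\to M$ with $t_n(uv)=t_n(vu)$ and $t_{n+1}(\iota_n(u)s_n^{\pm1})=t_n(u)$ for all $u,v\in\widetilde{BMW}_n$, where $\iota_n:\widetilde{BMW}_n\to\widetilde{BMW}_{n+1}$ is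 $s_i\mapsto s_i$. $(t_n^H)$ is the Ocneanu trace: let $\mathcal{H}_n(b,c)$ be the quotient of $RB_n$ by $(s_i-b)(s_i-c)=0$; the projection $H_n\to\mathcal{H}_n(b,c)$ factors through $\widetilde{BMW}_n$, and $t_n^H:\widetilde{BMW}_n\to S$ is the Markov trace factoring through $(\mathcal{H}_n(b,c))$ normalized by $t_1^H(1)=1$ (classically it exists and is unique). $N$ is an $S$-module through $S\to S^\dagger[(y-1)^{-1}]$. *)

(* Defs.v *)
From HB Require Import structures.
From mathcomp Require Import all_boot all_order all_algebra.
From mathcomp Require Import finmap boolp.
From mathcomp Require Import ring.
From mathcomp.multinomials Require Import mpoly.
From mathcomp.multinomials Require monalg.

Set Implicit Arguments.
Unset Strict Implicit.
Unset Printing Implicit Defensive.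

Import GRing.Theory.

Local Open Scope ring_scope.
Local Open Scope quotient_scope.

(* An R-algebra as a ring A with a central homomorphism R -> A. The
   library's [algType] requires 1 != 0, which the quotients below do not assume. *)
HB.mixin Record hasStructureMap (R : comPzRingType) A of GRing.PzRing A := {
  smap : {rmorphism R -> A};
  smapC : forall (k : R) (u : A), smap k * u = u * smap k
}.

#[short(type="pzAlgType")]
HB.structure Definition PzAlgebra (R : comPzRingType) :=
  {A of GRing.PzRing A & hasStructureMap R A}.

Section PropQuotient.
Variables (T : Type) (e : T -> T -> Prop).
Hypotheses (e_refl : forall u, e u u) (e_sym : forall u v, e u v -> e v u).
Hypothesis (e_trans : forall u v w, e u v -> e v w -> e u w).

Definition propb : rel T := fun u v => `[< e u v >].

Lemma propb_equiv : equiv_class_of propb.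
Proof.
split=> [u|u v|v u w]; first exact/asboolP.
- by apply/asboolP/asboolP; apply: e_sym.
- by move=> /asboolP uv /asboolP vw; apply/asboolP; apply: e_trans vw.
Qed.
End PropQuotient.

(* The localization A[f^-1]; [frac f p n] is the fraction p / f ^ n. *)
Section Localization.
Variables (A : comPzRingType) (f : A).

Definition loc_rel (p q : A * nat) : Prop :=
  exists k, f ^+ k * (p.1 * f ^+ q.2) = f ^+ k * (q.1 * f ^+ p.2).

Lemma loc_relP : equiv_class_of (propb loc_rel).
Proof.
apply: propb_equiv => [p|p q [k e]|p q r [k e] [l e']]; first by exists 0.
  by exists k.
exists (k + l + q.2)%N; rewrite !exprD.
have -> : f ^+ k * f ^+ l * f ^+ q.2 * (p.1 * f ^+ r.2) =
  f ^+ k * (p.1 * f ^+ q.2) * (f ^+ l * f ^+ r.2) by ring.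
rewrite e.
have -> : f ^+ k * (q.1 * f ^+ p.2) * (f ^+ l * f ^+ r.2) =
  f ^+ l * (q.1 * f ^+ r.2) * (f ^+ k * f ^+ p.2) by ring.
by rewrite e'; ring.
Qed.
Canonical loc_equiv := EquivRelPack loc_relP.

Definition loc := {eq_quot loc_equiv}.
HB.instance Definition _ := Choice.on loc.
HB.instance Definition _ : EqQuotient _ loc_equiv loc := EqQuotient.on loc.

Definition frac (p : A) (n : nat) : loc := \pi_loc (p, n).

Lemma fracP p n q m : frac p n = frac q m <-> loc_rel (p, n) (q, m).
Proof. by split=> [/eqmodP/asboolP|h]; last exact/eqmodP/asboolP. Qed.

Lemma frac_repr (u : loc) : frac (repr u).1 (repr u).2 = u.
Proof. by rewrite /frac -surjective_pairing reprK. Qed.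

Lemma frac_ind (P : loc -> Prop) :
  (forall p n, P (frac p n)) -> forall u, P u.
Proof. by move=> h u; rewrite -(frac_repr u). Qed.

Definition loc_add (u v : loc) : loc :=
  let p := repr u in let q := repr v in
  frac (p.1 * f ^+ q.2 + q.1 * f ^+ p.2) (p.2 + q.2).
Definition loc_opp (u : loc) : loc := frac (- (repr u).1) (repr u).2.
Definition loc_mul (u v : loc) : loc :=
  let p := repr u in let q := repr v in frac (p.1 * q.1) (p.2 + q.2).

Lemma repr_frac p n : exists k, forall p' n',
  repr (frac p n) = (p', n') -> f ^+ k * (p' * f ^+ n) = f ^+ k * (p * f ^+ n').
Proof.
have /fracP[k h] := frac_repr (frac p n).
by exists k => p' n' e; move: h; rewrite e.
Qed.

Lemma loc_addE p n q m :
  loc_add (frac p n) (frac q m) = frac (p * f ^+ m + q * f ^+ n) (n + m).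
Proof.
rewrite /loc_add; have [k] := repr_frac p n; have [l] := repr_frac q m.
case: (repr (frac p n)) (repr (frac q m)) => [p' n'] [q' m'].
move=> /(_ _ _ erefl) e' /(_ _ _ erefl) e; apply/fracP; exists (k + l)%N => /=.
rewrite !exprD; transitivity (f ^+ k * (p' * f ^+ n) * f ^+ l * f ^+ m * f ^+ m'
  + f ^+ l * (q' * f ^+ m) * f ^+ k * f ^+ n * f ^+ n'); first by ring.
by rewrite e e'; ring.
Qed.

Lemma loc_oppE p n : loc_opp (frac p n) = frac (- p) n.
Proof.
rewrite /loc_opp; have [k] := repr_frac p n.
case: (repr (frac p n)) => [p' n'] /(_ _ _ erefl) e.
by apply/fracP; exists k => /=; rewrite !mulNr !mulrN e.
Qed.

Lemma loc_mulE p n q m :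
  loc_mul (frac p n) (frac q m) = frac (p * q) (n + m).
Proof.
rewrite /loc_mul; have [k] := repr_frac p n; have [l] := repr_frac q m.
case: (repr (frac p n)) (repr (frac q m)) => [p' n'] [q' m'].
move=> /(_ _ _ erefl) e' /(_ _ _ erefl) e; apply/fracP; exists (k + l)%N => /=.
rewrite !exprD; transitivity ((f ^+ k * (p' * f ^+ n)) * (f ^+ l * (q' * f ^+ m)));
  first by ring.
by rewrite e e'; ring.
Qed.

Lemma frac_eq p n q m : p * f ^+ m = q * f ^+ n -> frac p n = frac q m.
Proof. by move=> e; apply/fracP; exists 0%N; rewrite /= e. Qed.

Lemma loc_addA : associative loc_add.
Proof.
elim/frac_ind=> p n; elim/frac_ind=> q m; elim/frac_ind=> r k.
by rewrite !loc_addE; apply: frac_eq; rewrite !exprD; ring.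
Qed.

Lemma loc_addC : commutative loc_add.
Proof.
elim/frac_ind=> p n; elim/frac_ind=> q m.
by rewrite !loc_addE; apply: frac_eq; rewrite !exprD; ring.
Qed.

Lemma loc_add0 : left_id (frac 0 0) loc_add.
Proof. by elim/frac_ind=> p n; rewrite !loc_addE; apply: frac_eq; ring. Qed.

Lemma loc_addN : left_inverse (frac 0 0) loc_opp loc_add.
Proof.
by elim/frac_ind=> p n; rewrite loc_oppE !loc_addE; apply: frac_eq; ring.
Qed.

Lemma loc_mulA : associative loc_mul.
Proof.
elim/frac_ind=> p n; elim/frac_ind=> q m; elim/frac_ind=> r k.
by rewrite !loc_mulE; apply: frac_eq; rewrite !exprD; ring.
Qed.

Lemma loc_mulC : commutative loc_mul.
Proof.
elim/frac_ind=> p n; elim/frac_ind=> q m.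
by rewrite !loc_mulE; apply: frac_eq; rewrite !exprD; ring.
Qed.

Lemma loc_mul1 : left_id (frac 1 0) loc_mul.
Proof. by elim/frac_ind=> p n; rewrite !loc_mulE; apply: frac_eq; ring. Qed.

Lemma loc_mulDl : left_distributive loc_mul loc_add.
Proof.
elim/frac_ind=> p n; elim/frac_ind=> q m; elim/frac_ind=> r k.
by rewrite !(loc_mulE, loc_addE); apply: frac_eq; rewrite !exprD; ring.
Qed.

HB.instance Definition _ := GRing.isZmodule.Build loc
  loc_addA loc_addC loc_add0 loc_addN.
HB.instance Definition _ := GRing.Zmodule_isComPzRing.Build loc
  loc_mulA loc_mulC loc_mul1 loc_mulDl.

Definition to_loc (p : A) : loc := frac p 0.

Lemma to_loc_zmod : zmod_morphism to_loc.
Proof.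
move=> p q; rewrite -[RHS]/(loc_add _ (loc_opp _)) loc_oppE loc_addE.
by apply: frac_eq; ring.
Qed.

Lemma to_loc_monoid : monoid_morphism to_loc.
Proof.
split=> // p q; rewrite -[RHS]/(loc_mul _ _) loc_mulE.
by apply: frac_eq; ring.
Qed.

HB.instance Definition _ := GRing.isZmodMorphism.Build A loc to_loc to_loc_zmod.
HB.instance Definition _ :=
  GRing.isMonoidMorphism.Build A loc to_loc to_loc_monoid.

Lemma fracE p n : frac p n * to_loc f ^+ n = to_loc p.
Proof.
rewrite -rmorphXn -[LHS]/(loc_mul _ _) loc_mulE.
by apply: frac_eq; rewrite !expr0 addn0; ring.
Qed.

Definition loc_scale (k : A) (u : loc) : loc := to_loc k * u.

Lemma loc_scaleA k l u : loc_scale k (loc_scale l u) = loc_scale (k * l) u.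
Proof. by rewrite /loc_scale rmorphM mulrA. Qed.
Lemma loc_scale1 : left_id 1 loc_scale.
Proof. by move=> u; rewrite /loc_scale rmorph1 mul1r. Qed.
Lemma loc_scaleDr : right_distributive loc_scale +%R.
Proof. by move=> k u v; rewrite /loc_scale mulrDr. Qed.
Lemma loc_scaleDl u : {morph loc_scale^~ u : k l / k + l}.
Proof. by move=> k l; rewrite /loc_scale rmorphD mulrDl. Qed.

HB.instance Definition _ := GRing.Zmodule_isLmodule.Build A loc
  loc_scaleA loc_scale1 loc_scaleDr loc_scaleDl.

End Localization.

(* The quotient of A by the two-sided ideal generated by the elements
   satisfying X. *)
Section IdealQuotient.
Variables (A : pzRingType) (X : A -> Prop).

Inductive ideal_gen : A -> Prop :=
| ideal_gen_in u : X u -> ideal_gen u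
| ideal_gen0 : ideal_gen 0
| ideal_genD u v : ideal_gen u -> ideal_gen v -> ideal_gen (u + v)
| ideal_genMl k u : ideal_gen u -> ideal_gen (k * u)
| ideal_genMr k u : ideal_gen u -> ideal_gen (u * k).

Lemma ideal_genN u : ideal_gen u -> ideal_gen (- u).
Proof. by move=> Iu; rewrite -mulN1r; apply: ideal_genMl. Qed.

Definition quor_rel (u v : A) := ideal_gen (u - v).

Lemma quor_relP : equiv_class_of (propb quor_rel).
Proof.
apply: propb_equiv => [u|u v|u v w]; rewrite /quor_rel.
- by rewrite subrr; apply: ideal_gen0.
- by rewrite -opprB => /ideal_genN; rewrite opprK.
- by move=> uv vw; rewrite -(subrK v u) -addrA; apply: ideal_genD.
Qed.
Canonical quor_equiv := EquivRelPack quor_relP.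

Definition quor := {eq_quot quor_equiv}.
HB.instance Definition _ := Choice.on quor.
HB.instance Definition _ : EqQuotient _ quor_equiv quor := EqQuotient.on quor.

Definition to_quor (u : A) : quor := \pi_quor u.

Lemma to_quorP u v : to_quor u = to_quor v <-> ideal_gen (u - v).
Proof. by split=> [/eqmodP/asboolP|h]; last exact/eqmodP/asboolP. Qed.

Lemma to_quor_repr (u : quor) : to_quor (repr u) = u.
Proof. exact: reprK. Qed.

Lemma quor_ind (P : quor -> Prop) :
  (forall u, P (to_quor u)) -> forall u, P u.
Proof. by move=> h u; rewrite -(to_quor_repr u). Qed.

Lemma repr_quor u : ideal_gen (repr (to_quor u) - u).
Proof. exact/to_quorP/to_quor_repr. Qed.

Definition quor_add (u v : quor) := to_quor (repr u + repr v).
Definition quor_opp (u : quor) := to_quor (- repr u).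
Definition quor_mul (u v : quor) := to_quor (repr u * repr v).

Lemma quor_addE u v : quor_add (to_quor u) (to_quor v) = to_quor (u + v).
Proof.
by apply/to_quorP; rewrite opprD addrACA; apply: ideal_genD; apply: repr_quor.
Qed.

Lemma quor_oppE u : quor_opp (to_quor u) = to_quor (- u).
Proof. by apply/to_quorP; rewrite -opprD; apply/ideal_genN/repr_quor. Qed.

Lemma quor_mulE u v : quor_mul (to_quor u) (to_quor v) = to_quor (u * v).
Proof.
apply/to_quorP; set u' := repr _; set v' := repr _.
have -> : u' * v' - u * v = u' * (v' - v) + (u' - u) * v.
  by rewrite mulrBr mulrBl addrA subrK.
by apply: ideal_genD; [apply: ideal_genMl|apply: ideal_genMr]; apply: repr_quor.
Qed.

Definition quorE := (quor_addE, quor_oppE, quor_mulE).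

Lemma quor_addA : associative quor_add.
Proof. by do 3![elim/quor_ind=> ?]; rewrite !quorE addrA. Qed.
Lemma quor_addC : commutative quor_add.
Proof. by do 2![elim/quor_ind=> ?]; rewrite !quorE addrC. Qed.
Lemma quor_add0 : left_id (to_quor 0) quor_add.
Proof. by elim/quor_ind=> ?; rewrite !quorE add0r. Qed.
Lemma quor_addN : left_inverse (to_quor 0) quor_opp quor_add.
Proof. by elim/quor_ind=> ?; rewrite !quorE addNr. Qed.
Lemma quor_mulA : associative quor_mul.
Proof. by do 3![elim/quor_ind=> ?]; rewrite !quorE mulrA. Qed.
Lemma quor_mul1 : left_id (to_quor 1) quor_mul.
Proof. by elim/quor_ind=> ?; rewrite !quorE mul1r. Qed.
Lemma quor_mulr1 : right_id (to_quor 1) quor_mul.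
Proof. by elim/quor_ind=> ?; rewrite !quorE mulr1. Qed.
Lemma quor_mulDl : left_distributive quor_mul quor_add.
Proof. by do 3![elim/quor_ind=> ?]; rewrite !quorE mulrDl. Qed.
Lemma quor_mulDr : right_distributive quor_mul quor_add.
Proof. by do 3![elim/quor_ind=> ?]; rewrite !quorE mulrDr. Qed.

HB.instance Definition _ := GRing.isZmodule.Build quor
  quor_addA quor_addC quor_add0 quor_addN.
HB.instance Definition _ := GRing.Zmodule_isPzRing.Build quor
  quor_mulA quor_mul1 quor_mulr1 quor_mulDl quor_mulDr.

Lemma to_quor_zmod : zmod_morphism to_quor.
Proof. by move=> u v; rewrite -[RHS]/(quor_add _ (quor_opp _)) !quorE. Qed.
Lemma to_quor_monoid : monoid_morphism to_quor.
Proof. by split=> // u v; rewrite -[RHS]/(quor_mul _ _) !quorE. Qed.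

HB.instance Definition _ :=
  GRing.isZmodMorphism.Build A quor to_quor to_quor_zmod.
HB.instance Definition _ :=
  GRing.isMonoidMorphism.Build A quor to_quor to_quor_monoid.

Lemma to_quor_eq0 u : to_quor u = 0 <-> ideal_gen u.
Proof. by rewrite -[0]/(to_quor 0) to_quorP subr0. Qed.
End IdealQuotient.

Section IdealQuotientCom.
Variables (A : comPzRingType) (X : A -> Prop).

Lemma quor_mulC : @commutative (quor X) _ *%R.
Proof. by do 2![elim/quor_ind=> ?]; rewrite -!rmorphM mulrC. Qed.

HB.instance Definition _ := GRing.PzRing_hasCommutativeMul.Build (quor X) quor_mulC.
End IdealQuotientCom.

Section IdealQuotientAlg.
Variables (R : comPzRingType) (A : pzAlgType R) (X : A -> Prop).

Definition quor_smap : {rmorphism R -> quor X} :=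
  (to_quor X : {rmorphism A -> quor X}) \o (smap : {rmorphism R -> A}).

Lemma quor_smapC (k : R) (u : quor X) : quor_smap k * u = u * quor_smap k.
Proof.
elim/quor_ind: u => u; rewrite -[quor_smap k]/(to_quor X (smap k)).
by rewrite -!rmorphM smapC.
Qed.

HB.instance Definition _ := hasStructureMap.Build R (quor X) quor_smapC.

Definition quor_scale (k : R) (u : quor X) : quor X := smap k * u.

Lemma quor_scaleA k l u : quor_scale k (quor_scale l u) = quor_scale (k * l) u.
Proof. by rewrite /quor_scale rmorphM mulrA. Qed.
Lemma quor_scale1 : left_id 1 quor_scale.
Proof. by move=> u; rewrite /quor_scale rmorph1 mul1r. Qed.
Lemma quor_scaleDr : right_distributive quor_scale +%R.
Proof. by move=> k u v; rewrite /quor_scale mulrDr. Qed.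
Lemma quor_scaleDl u : {morph quor_scale^~ u : k l / k + l}.
Proof. by move=> k l; rewrite /quor_scale rmorphD mulrDl. Qed.

HB.instance Definition _ := GRing.Zmodule_isLmodule.Build R (quor X)
  quor_scaleA quor_scale1 quor_scaleDr quor_scaleDl.

Lemma quor_scaleE (k : R) (u : quor X) : k *: u = smap k * u.
Proof. by []. Qed.
Lemma to_quor_smap (k : R) : to_quor X (smap k) = smap k.
Proof. by []. Qed.
Lemma quor_scalerAl (k : R) (u v : quor X) : k *: (u * v) = k *: u * v.
Proof. exact: mulrA. Qed.
Lemma quor_scalerAr (k : R) (u v : quor X) : k *: (u * v) = u * (k *: v).
Proof. by rewrite !quor_scaleE mulrA smapC -mulrA. Qed.
End IdealQuotientAlg.

(* The map A / (X) -> B / (Y) induced by f : A -> B. *)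
Section IdealQuotientMap.
Variables (A B : pzRingType) (X : A -> Prop) (Y : B -> Prop).
Variable f : {rmorphism A -> B}.

Definition quor_map (u : quor X) : quor Y := to_quor Y (f (repr u)).

Hypothesis fXY : forall u, X u -> Y (f u).

Lemma quor_mapE u : quor_map (to_quor X u) = to_quor Y (f u).
Proof.
apply/to_quorP; rewrite -rmorphB.
elim: (repr_quor X u) => [{}u /fXY|||k v|k v].
- exact: ideal_gen_in.
- by rewrite rmorph0; apply: ideal_gen0.
- by move=> v w _ Iv _ Iw; rewrite rmorphD; apply: ideal_genD.
- by move=> _ Iv; rewrite rmorphM; apply: ideal_genMl.
- by move=> _ Iv; rewrite rmorphM; apply: ideal_genMr.
Qed.

Lemma quor_map_zmod : zmod_morphism quor_map.
Proof.
by do 2![elim/quor_ind=> ?]; rewrite -rmorphB !quor_mapE !rmorphB.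
Qed.
Lemma quor_map_monoid : monoid_morphism quor_map.
Proof.
split; first by rewrite -(rmorph1 (to_quor X)) quor_mapE !rmorph1.
by do 2![elim/quor_ind=> ?]; rewrite -rmorphM !quor_mapE !rmorphM.
Qed.
End IdealQuotientMap.

(* The group generated by X subject to the relations u = v for [E u v]. The
   letters (x, false) and (x, true) stand for x and its inverse. *)
Section PresentedGroup.
Variables (X : choiceType).
Notation word := (seq (X * bool)).
Variable E : word -> word -> Prop.

Inductive wcong : word -> word -> Prop :=
| wcong_refl u : wcong u u
| wcong_sym u v : wcong u v -> wcong v u
| wcong_trans u v w : wcong u v -> wcong v w -> wcong u w
| wcong_rel l u v r : E u v -> wcong (l ++ u ++ r) (l ++ v ++ r)
| wcong_cancel l x e r : wcong (l ++ [:: (x, e); (x, ~~ e)] ++ r) (l ++ r).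

Lemma wcongP : equiv_class_of (propb wcong).
Proof.
exact: (propb_equiv wcong_refl wcong_sym wcong_trans).
Qed.
Canonical wcong_equiv := EquivRelPack wcongP.

Definition prgroup := {eq_quot wcong_equiv}.
HB.instance Definition _ := Choice.on prgroup.
HB.instance Definition _ : EqQuotient _ wcong_equiv prgroup :=
  EqQuotient.on prgroup.

Definition prg_word (u : word) : prgroup := \pi_prgroup u.

Lemma prg_wordP u v : prg_word u = prg_word v <-> wcong u v.
Proof. by split=> [/eqmodP/asboolP|h]; last exact/eqmodP/asboolP. Qed.

Lemma prg_word_repr g : prg_word (repr g) = g.
Proof. exact: reprK. Qed.

Lemma prg_ind (P : prgroup -> Prop) :
  (forall u, P (prg_word u)) -> forall g, P g.
Proof. by move=> h g; rewrite -(prg_word_repr g). Qed.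

Lemma repr_prg u : wcong (repr (prg_word u)) u.
Proof. exact/prg_wordP/prg_word_repr. Qed.

Definition winv (u : word) : word := rev [seq (x.1, ~~ x.2) | x <- u].

Lemma wcong_catl u v w : wcong u v -> wcong (w ++ u) (w ++ v).
Proof.
elim=> [{}u|{}u {}v _|u1 v1 w1 _ h1 _|l u1 v1 r|l x e r].
- exact: wcong_refl.
- exact: wcong_sym.
- exact: wcong_trans.
- by rewrite !(catA w l); apply: wcong_rel.
- by rewrite !(catA w l); apply: wcong_cancel.
Qed.

Lemma wcong_catr u v w : wcong u v -> wcong (u ++ w) (v ++ w).
Proof.
elim=> [{}u|{}u {}v _|u1 v1 w1 _ h1 _|l u1 v1 r|l x e r].
- exact: wcong_refl.
- exact: wcong_sym.
- exact: wcong_trans.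
- by rewrite -!catA; apply: wcong_rel.
- by rewrite -!catA; apply: wcong_cancel.
Qed.

Lemma wcong_cat u u' v v' :
  wcong u u' -> wcong v v' -> wcong (u ++ v) (u' ++ v').
Proof.
by move=> uu' vv'; apply: wcong_trans (wcong_catr v uu') (wcong_catl u' vv').
Qed.

Lemma winv_cat u v : winv (u ++ v) = winv v ++ winv u.
Proof. by rewrite /winv map_cat rev_cat. Qed.

Lemma winvK : involutive winv.
Proof.
move=> u; rewrite /winv map_rev revK -map_comp -[RHS]map_id.
by apply: eq_map => -[x e] /=; rewrite negbK.
Qed.

Lemma wcong_mulV u : wcong (u ++ winv u) [::].
Proof.
elim/last_ind: u => [|u [x e] IH]; first exact: wcong_refl.
rewrite -cats1 winv_cat -catA; apply: wcong_trans IH.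
exact: (wcong_cancel u x e (winv u)).
Qed.

Lemma wcong_Vmul u : wcong (winv u ++ u) [::].
Proof. by rewrite -{2}(winvK u); apply: wcong_mulV. Qed.

Lemma wcong_inv u v : wcong u v -> wcong (winv u) (winv v).
Proof.
move=> uv; apply: (@wcong_trans _ (winv u ++ v ++ winv v)).
  rewrite -[X in wcong X _]cats0.
  exact/wcong_catl/wcong_sym/wcong_mulV.
rewrite catA; apply: (@wcong_trans _ (winv u ++ u ++ winv v)).
  by rewrite -catA; apply/wcong_catl/wcong_catr/wcong_sym.
by rewrite catA; apply: (wcong_catr (winv v) (wcong_Vmul u)).
Qed.

Definition prg_mul (g h : prgroup) := prg_word (repr g ++ repr h).
Definition prg_inv (g : prgroup) := prg_word (winv (repr g)).

Lemma prg_mulE u v : prg_mul (prg_word u) (prg_word v) = prg_word (u ++ v).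
Proof. by apply/prg_wordP; apply: wcong_cat; apply: repr_prg. Qed.
Lemma prg_invE u : prg_inv (prg_word u) = prg_word (winv u).
Proof. by apply/prg_wordP; apply: wcong_inv; apply: repr_prg. Qed.

Lemma prg_mulA : associative prg_mul.
Proof. by do 3![elim/prg_ind=> ?]; rewrite !prg_mulE catA. Qed.
Lemma prg_mul1g : left_id (prg_word [::]) prg_mul.
Proof. by elim/prg_ind=> ?; rewrite prg_mulE. Qed.
Lemma prg_mulg1 : right_id (prg_word [::]) prg_mul.
Proof. by elim/prg_ind=> ?; rewrite prg_mulE cats0. Qed.
Lemma prg_mulVg : left_inverse (prg_word [::]) prg_inv prg_mul.
Proof.
by elim/prg_ind=> u; rewrite prg_invE prg_mulE; apply/prg_wordP/wcong_Vmul.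
Qed.
Lemma prg_mulgV : right_inverse (prg_word [::]) prg_inv prg_mul.
Proof.
by elim/prg_ind=> u; rewrite prg_invE prg_mulE; apply/prg_wordP/wcong_mulV.
Qed.

HB.instance Definition _ := isGroup.Build prgroup
  prg_mulA prg_mul1g prg_mulg1 prg_mulVg prg_mulgV.

Definition prg_gen (x : X) : prgroup := prg_word [:: (x, false)].
End PresentedGroup.

(* The homomorphism of presented groups sending the generator x to f x. *)
Section PresentedGroupMap.
Variables (X Y : choiceType) (f : X -> Y).
Variables (E : seq (X * bool) -> seq (X * bool) -> Prop).
Variables (F : seq (Y * bool) -> seq (Y * bool) -> Prop).

Definition wmap (u : seq (X * bool)) := [seq (f x.1, x.2) | x <- u].

Definition prg_map (g : prgroup E) : prgroup F := prg_word F (wmap (repr g)).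

Hypothesis fEF : forall u v, E u v -> F (wmap u) (wmap v).

Lemma wcong_map u v : wcong E u v -> wcong F (wmap u) (wmap v).
Proof.
elim=> [{}u|{}u {}v _|u1 v1 w1 _ h1 _|l u1 v1 r|l x e r].
- exact: wcong_refl.
- exact: wcong_sym.
- exact: wcong_trans.
- by move=> /fEF; rewrite /wmap !map_cat; apply: wcong_rel.
- by rewrite /wmap !map_cat; apply: wcong_cancel.
Qed.

Lemma prg_mapE u : prg_map (prg_word E u) = prg_word F (wmap u).
Proof. exact/prg_wordP/wcong_map/repr_prg. Qed.

Lemma prg_mapM : {morph prg_map : g h / (g * h)%g}.
Proof.
do 2![elim/prg_ind=> ?]; rewrite -[(_ * _)%g]/(prg_mul _ _) prg_mulE !prg_mapE.
by rewrite -[RHS]/(prg_mul _ _) prg_mulE /wmap map_cat.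
Qed.

Lemma prg_map1 : prg_map 1%g = 1%g.
Proof. exact: (prg_mapE [::]). Qed.
End PresentedGroupMap.

(* The group algebra A[G]. The library has a product on [malg K A] only for
   monoids K without nontrivial units. *)
Definition gralg (A : comPzRingType) (G : groupType) : Type := monalg.malg G A.

(* The element c g of A[G], locked to keep unification from unfolding it. *)
HB.lock Definition gr_term (A : comPzRingType) (G : groupType) (c : A) (g : G) :
  gralg A G := monalg.mkmalgU g c.

Arguments gr_term {A G}.

Section GroupAlgebra.
Import monalg.
Local Notation "g @_ k" := (mcoeff k g) : ring_scope.
Variables (A : comPzRingType) (G : groupType).
Implicit Types (g : gralg A G) (c : A) (k : G).

HB.instance Definition _ := GRing.Zmodule.on (gralg A G).

Definition gr_elt (k : G) : gralg A G := gr_term 1 k.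

Definition gr_mul g1 g2 : gralg A G :=
  \sum_(k1 <- msupp g1) \sum_(k2 <- msupp g2)
    gr_term (g1@_k1 * g2@_k2) (k1 * k2)%g.

Lemma gr_termE c k : gr_term c k = << c *g k >>.
Proof. by rewrite gr_term.unlock. Qed.

Lemma gr_term0 k : gr_term 0 k = 0 :> gralg A G.
Proof. by rewrite gr_termE; apply: monalgU0. Qed.

Lemma gr_termB k : {morph (fun c => gr_term c k : gralg A G) : c d / c - d}.
Proof. by move=> c d; rewrite !gr_termE; apply: monalgUB. Qed.

Lemma gr_termD k : {morph (fun c => gr_term c k : gralg A G) : c d / c + d}.
Proof. by move=> c d; rewrite !gr_termE; apply: monalgUD. Qed.

Lemma gr_mulw (d1 d2 : {fset G}) g1 g2 :
  (msupp g1 `<=` d1)%fset -> (msupp g2 `<=` d2)%fset ->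
  gr_mul g1 g2 =
    \sum_(k1 <- d1) \sum_(k2 <- d2) gr_term (g1@_k1 * g2@_k2) (k1 * k2)%g.
Proof.
move=> le_d1 le_d2; rewrite /gr_mul (big_fset_incl _ le_d1) /=.
  apply/eq_bigr=> k1 _; apply/big_fset_incl => // k _ /mcoeff_outdom ->.
  by rewrite mulr0 gr_term0.
move=> k _ /mcoeff_outdom g1k.
by rewrite big1 => // k' _; rewrite g1k mul0r gr_term0.
Qed.

Lemma gr_mulDl : left_distributive gr_mul +%R.
Proof.
move=> g1 g2 g.
rewrite [in RHS](gr_mulw (fsubsetUl _ (msupp g2)) (fsubset_refl _)).
rewrite [in RHS](gr_mulw (fsubsetUr (msupp g1) _) (fsubset_refl _)).
rewrite (gr_mulw (msuppD_le _ _) (fsubset_refl _)) -big_split /=.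
apply/eq_bigr=> k1 _; rewrite -big_split /=; apply/eq_bigr=> k2 _.
by rewrite mcoeffD mulrDl gr_termD.
Qed.

Lemma gr_mulDr : right_distributive gr_mul +%R.
Proof.
move=> g g1 g2.
rewrite [in RHS](gr_mulw (fsubset_refl _) (fsubsetUl _ (msupp g2))).
rewrite [in RHS](gr_mulw (fsubset_refl _) (fsubsetUr (msupp g1) _)).
rewrite (gr_mulw (fsubset_refl _) (msuppD_le _ _)) -big_split /=.
apply/eq_bigr=> k1 _; rewrite -big_split /=; apply/eq_bigr=> k2 _.
by rewrite mcoeffD mulrDr gr_termD.
Qed.

Lemma gr_mul0l : left_zero 0 gr_mul.
Proof. by move=> g; rewrite /gr_mul msupp0 big_seq_fset0. Qed.

Lemma gr_mul0r : right_zero 0 gr_mul.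
Proof.
by move=> g; rewrite /gr_mul big1 // => k _; rewrite msupp0 big_seq_fset0.
Qed.

Lemma gr_mulUU c1 c2 k1 k2 :
  gr_mul (gr_term c1 k1) (gr_term c2 k2) = gr_term (c1 * c2) (k1 * k2)%g.
Proof. by rewrite !(gr_termE c1, gr_termE c2) (gr_mulw msuppU_le msuppU_le) !big_seq_fset1 !mcoeffUU. Qed.

Lemma gr_mul_suml (I : Type) (s : seq I) F g :
  gr_mul (\sum_(i <- s) F i) g = \sum_(i <- s) gr_mul (F i) g.
Proof.
exact: (big_morph (gr_mul^~ g) (fun _ _ => gr_mulDl _ _ _) (gr_mul0l _)).
Qed.

Lemma gr_mul_sumr (I : Type) (s : seq I) F g :
  gr_mul g (\sum_(i <- s) F i) = \sum_(i <- s) gr_mul g (F i).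
Proof.
exact: (big_morph (gr_mul g) (fun _ _ => gr_mulDr _ _ _) (gr_mul0r _)).
Qed.

Lemma gr_ind (P : gralg A G -> Prop) :
  P 0 -> (forall g1 g2, P g1 -> P g2 -> P (g1 + g2)) ->
  (forall c k, P (gr_term c k)) -> forall g, P g.
Proof.
move=> P0 PD PU g; rewrite [g]monalgE; apply: big_ind => // k _.
by rewrite -gr_termE; apply: PU.
Qed.

Lemma gr_mulA : associative gr_mul.
Proof.
move=> g1 g2 g3; elim/gr_ind: g1 => [|? ? h1 h2|c1 k1].
- by rewrite !gr_mul0l.
- by rewrite !gr_mulDl h1 h2.
elim/gr_ind: g2 => [|? ? h1 h2|c2 k2].
- by rewrite !(gr_mul0l, gr_mul0r).
- by rewrite !(gr_mulDl, gr_mulDr) h1 h2.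
elim/gr_ind: g3 => [|? ? h1 h2|c3 k3].
- by rewrite !gr_mul0r.
- by rewrite !gr_mulDr h1 h2.
by rewrite !gr_mulUU mulrA mulgA.
Qed.

Lemma gr_mul1g : left_id (gr_elt 1) gr_mul.
Proof.
elim/gr_ind=> [|? ? h1 h2|c k]; first exact: gr_mul0r.
- by rewrite gr_mulDr h1 h2.
- by rewrite gr_mulUU mul1r mul1g.
Qed.

Lemma gr_mulg1 : right_id (gr_elt 1) gr_mul.
Proof.
elim/gr_ind=> [|? ? h1 h2|c k]; first exact: gr_mul0l.
- by rewrite gr_mulDl h1 h2.
- by rewrite gr_mulUU mulr1 mulg1.
Qed.

HB.instance Definition _ := GRing.Zmodule_isPzRing.Build (gralg A G)
  gr_mulA gr_mul1g gr_mulg1 gr_mulDl gr_mulDr.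

Definition gr_smap (c : A) : gralg A G := gr_term c 1%g.

Lemma gr_smap_zmod : zmod_morphism gr_smap.
Proof. exact: gr_termB. Qed.
Lemma gr_smap_monoid : monoid_morphism gr_smap.
Proof.
by split=> // c d; rewrite -[RHS]/(gr_mul _ _) gr_mulUU mul1g.
Qed.

Lemma gr_smapC c g : gr_smap c * g = g * gr_smap c.
Proof.
elim/gr_ind: g => [|? ? h1 h2|d k]; first by rewrite mulr0 mul0r.
  by rewrite mulrDr mulrDl h1 h2.
by rewrite -![_ * _]/(gr_mul _ _) !gr_mulUU mulrC mul1g mulg1.
Qed.

Lemma gr_eltM k1 k2 : gr_elt (k1 * k2) = gr_elt k1 * gr_elt k2.
Proof. by rewrite -[RHS]/(gr_mul _ _) gr_mulUU mulr1. Qed.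

Lemma gr_elt1 : gr_elt 1 = 1.
Proof. by []. Qed.

End GroupAlgebra.

Section GroupAlgebraStructureMap.
Variables (A : comPzRingType) (G : groupType).

HB.instance Definition _ :=
  GRing.isZmodMorphism.Build A (gralg A G) (@gr_smap A G) (@gr_smap_zmod A G).
HB.instance Definition _ :=
  GRing.isMonoidMorphism.Build A (gralg A G) (@gr_smap A G) (@gr_smap_monoid A G).
HB.instance Definition _ :=
  hasStructureMap.Build A (gralg A G) (@gr_smapC A G).
End GroupAlgebraStructureMap.

(* The algebra homomorphism A[G] -> B extending f : G -> B. *)
Section GroupAlgebraLift.
Import monalg.
Local Notation "g @_ k" := (mcoeff k g) : ring_scope.
Variables (A : comPzRingType) (G : groupType) (B : pzAlgType A) (f : G -> B).
Implicit Types (g : gralg A G) (c : A) (k : G).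

Definition gr_lift (g : gralg A G) : B :=
  \sum_(k <- msupp g) smap (g@_k) * f k.

Lemma gr_liftw (d : {fset G}) g :
  (msupp g `<=` d)%fset -> gr_lift g = \sum_(k <- d) smap (g@_k) * f k.
Proof.
move=> le_d; apply: big_fset_incl => // k _ /mcoeff_outdom ->.
by rewrite rmorph0 mul0r.
Qed.

Lemma gr_liftU c k : gr_lift (gr_term c k) = smap c * f k.
Proof. by rewrite gr_termE (gr_liftw msuppU_le) big_seq_fset1 mcoeffUU. Qed.

Lemma gr_lift_zmod : zmod_morphism gr_lift.
Proof.
move=> g1 g2; rewrite (gr_liftw (msuppB_le _ _)).
rewrite (gr_liftw (fsubsetUl (msupp g1) (msupp g2))).
rewrite (gr_liftw (fsubsetUr (msupp g1) (msupp g2))).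
rewrite -sumrB; apply/eq_bigr=> k _.
by rewrite mcoeffB rmorphB mulrBl.
Qed.

Lemma gr_lift0 : gr_lift 0 = 0.
Proof. by rewrite -(subrr 0) gr_lift_zmod subrr. Qed.
Lemma gr_liftD g1 g2 : gr_lift (g1 + g2) = gr_lift g1 + gr_lift g2.
Proof.
have gN g : gr_lift (- g) = - gr_lift g.
  by rewrite -[- g]sub0r gr_lift_zmod gr_lift0 sub0r.
by rewrite -{1}[g2]opprK gr_lift_zmod gN opprK.
Qed.

Hypotheses (f1 : f 1%g = 1) (fM : {morph f : k l / (k * l)%g >-> k * l}).

Lemma gr_lift_monoid : monoid_morphism gr_lift.
Proof.
split=> [|g1 g2]; first by rewrite gr_liftU f1 rmorph1 mulr1.
elim/gr_ind: g1 => [|? ? h1 h2|c1 k1].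
- by rewrite mul0r gr_lift0 mul0r.
- by rewrite mulrDl !gr_liftD mulrDl h1 h2.
elim/gr_ind: g2 => [|? ? h1 h2|c2 k2].
- by rewrite mulr0 gr_lift0 mulr0.
- by rewrite mulrDr !gr_liftD mulrDr h1 h2.
rewrite -[_ * _]/(gr_mul _ _) gr_mulUU !gr_liftU fM rmorphM.
by rewrite -!mulrA; congr (_ * _); rewrite !mulrA smapC.
Qed.

Lemma gr_lift_elt k : gr_lift (gr_elt A k) = f k.
Proof. by rewrite gr_liftU rmorph1 mul1r. Qed.

Lemma gr_lift_smap c : gr_lift (smap c) = smap c.
Proof. by rewrite gr_liftU f1 mulr1. Qed.
End GroupAlgebraLift.

HB.instance Definition _ (A : comPzRingType) (G : groupType) (B : pzAlgType A)
    (f : G -> B) :=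
  GRing.isZmodMorphism.Build (gralg A G) B (gr_lift f) (gr_lift_zmod f).

(* Extension of scalars M (x)_R T along phi : R -> T: finite formal sums
   sum_i m_i (x) a_i, modulo biadditivity and (r m) (x) a = m (x) (phi(r) a). *)
Section ExtensionOfScalars.
Variables (R T : comPzRingType) (phi : {rmorphism R -> T}) (M : lmodType R).

Inductive tcong : seq (M * T) -> seq (M * T) -> Prop :=
| tcong_refl u : tcong u u
| tcong_sym u v : tcong u v -> tcong v u
| tcong_trans u v w : tcong u v -> tcong v w -> tcong u w
| tcong_cat u u' v v' :
    tcong u u' -> tcong v v' -> tcong (u ++ v) (u' ++ v')
| tcong_catC u v : tcong (u ++ v) (v ++ u)
| tcong_0l a : tcong [:: (0, a)] [::]
| tcong_Dl m m' a : tcong [:: (m + m', a)] [:: (m, a); (m', a)]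
| tcong_Dr m a a' : tcong [:: (m, a + a')] [:: (m, a); (m, a')]
| tcong_bal r m a : tcong [:: (r *: m, a)] [:: (m, phi r * a)].

Lemma tcongP : equiv_class_of (propb tcong).
Proof. exact: (propb_equiv tcong_refl tcong_sym tcong_trans). Qed.
Canonical tcong_equiv := EquivRelPack tcongP.

Definition ext_scalars := {eq_quot tcong_equiv}.
HB.instance Definition _ := Choice.on ext_scalars.
HB.instance Definition _ : EqQuotient _ tcong_equiv ext_scalars :=
  EqQuotient.on ext_scalars.

Definition tsum (u : seq (M * T)) : ext_scalars := \pi_ext_scalars u.

Definition tens (m : M) (a : T) : ext_scalars := tsum [:: (m, a)].

Lemma tsumP u v : tsum u = tsum v <-> tcong u v.
Proof. by split=> [/eqmodP/asboolP|h]; last exact/eqmodP/asboolP. Qed.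

Lemma tsum_repr u : tsum (repr u) = u.
Proof. exact: reprK. Qed.

Lemma tsum_ind (P : ext_scalars -> Prop) :
  (forall u, P (tsum u)) -> forall u, P u.
Proof. by move=> h u; rewrite -(tsum_repr u). Qed.

Lemma repr_tsum u : tcong (repr (tsum u)) u.
Proof. exact/tsumP/tsum_repr. Qed.

Definition sopp (u : seq (M * T)) := [seq (- p.1, p.2) | p <- u].
Definition sscale (k : T) (u : seq (M * T)) := [seq (p.1, k * p.2) | p <- u].

Lemma tcong_opp u v : tcong u v -> tcong (sopp u) (sopp v).
Proof.
rewrite /sopp.
elim=> [{}u|{}u {}v _|u1 v1 w1 _ h1 _|u1 u2 v1 v2 _ h1 _ h2|u1 v1|a|m m' a|m a a'|r m a] /=.
- exact: tcong_refl.
- exact: tcong_sym.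
- exact: tcong_trans.
- by rewrite !map_cat; apply: tcong_cat.
- by rewrite !map_cat; apply: tcong_catC.
- by rewrite oppr0; apply: tcong_0l.
- by rewrite opprD; apply: tcong_Dl.
- exact: tcong_Dr.
- by rewrite -scalerN; apply: tcong_bal.
Qed.

Lemma tcong_scale k u v : tcong u v -> tcong (sscale k u) (sscale k v).
Proof.
rewrite /sscale.
elim=> [{}u|{}u {}v _|u1 v1 w1 _ h1 _|u1 u2 v1 v2 _ h1 _ h2|u1 v1|a|m m' a|m a a'|r m a] /=.
- exact: tcong_refl.
- exact: tcong_sym.
- exact: tcong_trans.
- by rewrite !map_cat; apply: tcong_cat.
- by rewrite !map_cat; apply: tcong_catC.
- exact: tcong_0l.
- exact: tcong_Dl.
- by rewrite mulrDr; apply: tcong_Dr.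
- by rewrite mulrCA; apply: tcong_bal.
Qed.

Definition ext_add (u v : ext_scalars) := tsum (repr u ++ repr v).
Definition ext_opp (u : ext_scalars) := tsum (sopp (repr u)).
Definition ext_scale (k : T) (u : ext_scalars) := tsum (sscale k (repr u)).

Lemma ext_addE u v : ext_add (tsum u) (tsum v) = tsum (u ++ v).
Proof. by apply/tsumP; apply: tcong_cat; apply: repr_tsum. Qed.
Lemma ext_oppE u : ext_opp (tsum u) = tsum (sopp u).
Proof. by apply/tsumP; apply: tcong_opp; apply: repr_tsum. Qed.
Lemma ext_scaleE k u : ext_scale k (tsum u) = tsum (sscale k u).
Proof. by apply/tsumP; apply: tcong_scale; apply: repr_tsum. Qed.

Lemma ext_addA : associative ext_add.
Proof. by do 3![elim/tsum_ind=> ?]; rewrite !ext_addE catA. Qed.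
Lemma ext_addC : commutative ext_add.
Proof.
by do 2![elim/tsum_ind=> ?]; rewrite !ext_addE; apply/tsumP/tcong_catC.
Qed.
Lemma ext_add0 : left_id (tsum [::]) ext_add.
Proof. by elim/tsum_ind=> ?; rewrite ext_addE. Qed.

Lemma ext_cons p u : tsum (p :: u) = ext_add (tens p.1 p.2) (tsum u).
Proof. by case: p => m a; rewrite ext_addE. Qed.

Lemma ext_addACA u v w z :
  ext_add (ext_add u v) (ext_add w z) = ext_add (ext_add u w) (ext_add v z).
Proof.
rewrite -!ext_addA; congr ext_add.
by rewrite !ext_addA (ext_addC v).
Qed.

Lemma ext_addN : left_inverse (tsum [::]) ext_opp ext_add.
Proof.
elim/tsum_ind=> u; rewrite ext_oppE; elim: u => [|[m a] u IH] /=.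
  by rewrite ext_addE.
rewrite !ext_cons /= ext_addACA IH; have -> : ext_add (tens (- m) a) (tens m a) = tsum [::].
  rewrite ext_addE; apply/tsumP; apply: tcong_trans (tcong_0l a).
  by rewrite -(addNr m); apply/tcong_sym/tcong_Dl.
by rewrite ext_add0.
Qed.

HB.instance Definition _ := GRing.isZmodule.Build ext_scalars
  ext_addA ext_addC ext_add0 ext_addN.

Lemma tsumD u v : tsum (u ++ v) = tsum u + tsum v.
Proof. by rewrite -ext_addE. Qed.

Lemma tsum_cons p u : tsum (p :: u) = tens p.1 p.2 + tsum u.
Proof. exact: ext_cons. Qed.

Lemma ext_scaleA k l u : ext_scale k (ext_scale l u) = ext_scale (k * l) u.
Proof.
elim/tsum_ind: u => u; rewrite !ext_scaleE /sscale -map_comp.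
by congr tsum; apply: eq_map => p /=; rewrite mulrA.
Qed.
Lemma ext_scale1 : left_id 1 ext_scale.
Proof.
elim/tsum_ind=> u; rewrite ext_scaleE /sscale -[in RHS](map_id u).
by congr tsum; apply: eq_map => -[m a] /=; rewrite mul1r.
Qed.
Lemma ext_scaleDr : right_distributive ext_scale +%R.
Proof.
move=> k; do 2![elim/tsum_ind=> ?].
by rewrite -tsumD !ext_scaleE -tsumD /sscale map_cat.
Qed.
Lemma ext_scaleDl u : {morph ext_scale^~ u : k l / k + l}.
Proof.
elim/tsum_ind: u => u k l; rewrite !ext_scaleE.
elim: u => [|[m a] u IH] /=; first by rewrite -tsumD.
rewrite !tsum_cons /= IH addrACA; congr (_ + _).
by rewrite -tsumD /= mulrDl; apply/tsumP/tcong_Dr.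
Qed.

HB.instance Definition _ := GRing.Zmodule_isLmodule.Build T ext_scalars
  ext_scaleA ext_scale1 ext_scaleDr ext_scaleDl.

Lemma tens_zmodl a : zmod_morphism (tens^~ a).
Proof.
move=> m m'; apply: (addIr (tens m' a)); rewrite subrK -tsumD /=.
by apply/tsumP/tcong_sym; rewrite -{1}(subrK m' m); apply: tcong_Dl.
Qed.
Lemma tens_zmodr m : zmod_morphism (tens m).
Proof.
move=> a a'; apply: (addIr (tens m a')); rewrite subrK -tsumD /=.
by apply/tsumP/tcong_sym; rewrite -{1}(subrK a' a); apply: tcong_Dr.
Qed.
Lemma tens_balanced r m a : tens (r *: m) a = tens m (phi r * a).
Proof. exact/tsumP/tcong_bal. Qed.
Lemma tens_scale k m a : k *: tens m a = tens m (k * a).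
Proof. exact: ext_scaleE. Qed.
End ExtensionOfScalars.

(* The braid group on n strands. Its generators are indexed from 0: for
   i : 'I_n.-1, [braid_gen i] is the Artin generator s_(i+1). *)
Definition pos (k : nat) (i : 'I_k) : 'I_k * bool := (i, false).

Inductive braid_rel (k : nat) : seq ('I_k * bool) -> seq ('I_k * bool) -> Prop :=
| braid_far (i j : 'I_k) : (i.+1 < j)%N ->
    braid_rel [:: pos i; pos j] [:: pos j; pos i]
| braid_near (i j : 'I_k) : i.+1 = j ->
    braid_rel [:: pos i; pos j; pos i] [:: pos j; pos i; pos j].

Definition braid (n : nat) := prgroup (@braid_rel n.-1).
HB.instance Definition _ n := Group.on (braid n).

Definition braid_gen (n : nat) (i : 'I_n.-1) : braid n := prg_gen _ i.

(* The inclusion B_(n+1) -> B_(n+2), s_i |-> s_i. *)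
Definition braid_incl (n : nat) : braid n.+1 -> braid n.+2 :=
  prg_map (widen_ord (leqnSn n)) (@braid_rel n.+1).

Lemma braid_incl_rel n u v :
  @braid_rel n u v ->
  @braid_rel n.+1 (wmap (widen_ord (leqnSn n)) u) (wmap (widen_ord (leqnSn n)) v).
Proof. by case=> i j ij; [apply: braid_far|apply: braid_near]. Qed.

Lemma braid_inclM n : {morph @braid_incl n : g h / (g * h)%g}.
Proof. exact: prg_mapM (@braid_incl_rel n). Qed.

Lemma braid_incl1 n : @braid_incl n 1%g = 1%g.
Proof. exact: prg_map1 (@braid_incl_rel n). Qed.

Lemma braid_inclV n g : @braid_incl n g^-1%g = (braid_incl g)^-1%g.
Proof.
by apply: (mulgI (braid_incl g)); rewrite -braid_inclM !mulgV braid_incl1.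
Qed.

Lemma braid_incl_gen n (i : 'I_n) :
  braid_incl (@braid_gen n.+1 i) = @braid_gen n.+2 (widen_ord (leqnSn n) i).
Proof. exact: (prg_mapE (@braid_incl_rel n)). Qed.

Section CubicAlgebras.
Variables (R : comPzRingType) (a b c : R).

Definition RB (n : nat) := gralg R (braid n).

Definition RB_gen (n : nat) (i : 'I_n.-1) : RB n := gr_elt R (braid_gen i).

Definition cubic_rel (n : nat) (u : RB n) : Prop :=
  exists i : 'I_n.-1,
    u = (RB_gen i - smap a) * (RB_gen i - smap b) * (RB_gen i - smap c).

Definition Hcubic (n : nat) := quor (@cubic_rel n).

Definition H_of (n : nat) (g : braid n) : Hcubic n :=
  to_quor (@cubic_rel n) (gr_elt R g).

(* The element R_i, for consecutive generators s_i and s_j = s_(i+1). *)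
Definition bmw_elt (n : nat) (i j : 'I_n.-1) : Hcubic n :=
  let x := b + c in let y := b * c in
  let s := H_of (braid_gen i) in let s' := H_of (braid_gen i)^-1%g in
  let t := H_of (braid_gen j) in let t' := H_of (braid_gen j)^-1%g in
  - (y *: (s * t' * s)) + y ^+ 2 *: (t' * s * t') - s * t * s
  - (x * y ^+ 2) *: (t' ^+ 2) + x *: (s ^+ 2) + y ^+ 3 *: (t' * s' * t').

Definition bmw_rel (n : nat) (u : Hcubic n) : Prop :=
  exists i j : 'I_n.-1, i.+1 = j /\ u = bmw_elt i j.

Definition BMW (n : nat) := quor (@bmw_rel n).

Definition to_BMW (n : nat) (u : RB n) : BMW n :=
  to_quor (@bmw_rel n) (to_quor (@cubic_rel n) u).

Definition BMW_of (n : nat) (g : braid n) : BMW n := to_BMW (gr_elt R g).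

Section Inclusion.
Variable n : nat.

Definition RB_incl : RB n.+1 -> RB n.+2 :=
  gr_lift (fun g : braid n.+1 => gr_elt R (braid_incl g)).

Lemma RB_incl_monoid : monoid_morphism RB_incl.
Proof.
apply: gr_lift_monoid => [|g h /=]; first by rewrite braid_incl1.
by rewrite braid_inclM gr_eltM.
Qed.

HB.instance Definition _ :=
  GRing.isZmodMorphism.Build (RB n.+1) (RB n.+2) RB_incl (gr_lift_zmod _).
HB.instance Definition _ :=
  GRing.isMonoidMorphism.Build (RB n.+1) (RB n.+2) RB_incl RB_incl_monoid.

Lemma RB_incl_elt g : RB_incl (gr_elt R g) = gr_elt R (braid_incl g).
Proof. exact: gr_lift_elt. Qed.

Lemma RB_incl_smap k : RB_incl (smap k) = smap k.
Proof. by apply: gr_lift_smap; rewrite braid_incl1. Qed.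

Lemma RB_incl_cubic u : cubic_rel u -> cubic_rel (RB_incl u).
Proof.
move=> [i ->]; exists (widen_ord (leqnSn n) i).
by rewrite !rmorphM !rmorphB /= !RB_incl_smap RB_incl_elt braid_incl_gen.
Qed.

Definition H_incl : Hcubic n.+1 -> Hcubic n.+2 :=
  quor_map (@cubic_rel n.+2) RB_incl.

Lemma H_inclE u :
  H_incl (to_quor (@cubic_rel n.+1) u) = to_quor (@cubic_rel n.+2) (RB_incl u).
Proof. exact: quor_mapE RB_incl_cubic u. Qed.

HB.instance Definition _ :=
  GRing.isZmodMorphism.Build (Hcubic n.+1) (Hcubic n.+2) H_incl
    (quor_map_zmod RB_incl_cubic).
HB.instance Definition _ :=
  GRing.isMonoidMorphism.Build (Hcubic n.+1) (Hcubic n.+2) H_incl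
    (quor_map_monoid RB_incl_cubic).

Lemma H_inclZ k u : H_incl (k *: u) = k *: H_incl u.
Proof.
rewrite !quor_scaleE (rmorphM H_incl); congr (_ * _).
by rewrite -[LHS]/(H_incl (to_quor _ (smap k))) H_inclE RB_incl_smap.
Qed.

Lemma H_incl_of g : H_incl (H_of g) = H_of (braid_incl g).
Proof. by rewrite H_inclE RB_incl_elt. Qed.

Lemma H_incl_bmw u : bmw_rel u -> bmw_rel (H_incl u).
Proof.
move=> [i [j [ij ->]]].
exists (widen_ord (leqnSn n) i), (widen_ord (leqnSn n) j); split=> //.
rewrite /bmw_elt !expr2 !(rmorphD, rmorphN) /= !H_inclZ !rmorphM /=.
by rewrite !H_incl_of !braid_inclV !braid_incl_gen.
Qed.

(* iota : BMW_(n+1) -> BMW_(n+2), s_i |-> s_i. *)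
Definition iota_BMW : BMW n.+1 -> BMW n.+2 := quor_map (@bmw_rel n.+2) H_incl.

Lemma iota_BMW_quor u :
  iota_BMW (to_quor (@bmw_rel n.+1) u) = to_quor (@bmw_rel n.+2) (H_incl u).
Proof. exact: quor_mapE H_incl_bmw u. Qed.

Lemma iota_BMWE u : iota_BMW (to_BMW u) = to_BMW (RB_incl u).
Proof. by rewrite iota_BMW_quor H_inclE. Qed.

HB.instance Definition _ :=
  GRing.isZmodMorphism.Build (BMW n.+1) (BMW n.+2) iota_BMW
    (quor_map_zmod H_incl_bmw).
HB.instance Definition _ :=
  GRing.isMonoidMorphism.Build (BMW n.+1) (BMW n.+2) iota_BMW
    (quor_map_monoid H_incl_bmw).

Lemma iota_BMWZ k u : iota_BMW (k *: u) = k *: iota_BMW u.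
Proof.
rewrite !quor_scaleE (rmorphM iota_BMW); congr (_ * _).
by rewrite -[LHS]/(iota_BMW (to_BMW (smap k))) iota_BMWE RB_incl_smap.
Qed.

Lemma iota_BMW_gen (i : 'I_n) :
  iota_BMW (BMW_of (@braid_gen n.+1 i)) =
    BMW_of (@braid_gen n.+2 (widen_ord (leqnSn n) i)).
Proof. by rewrite iota_BMWE RB_incl_elt braid_incl_gen. Qed.
End Inclusion.

(* A Markov trace (t_n)_(n >= 1) is given with a shift: [t n] is defined on
   BMW n.+1. The last generator of the braid group on n.+2 strands is
   [braid_gen ord_max]. *)
Definition markov_trace (M : lmodType R)
    (t : forall n, {linear BMW n.+1 -> M}) : Prop :=
  (forall n (u v : BMW n.+1), t n (u * v) = t n (v * u)) /\
  (forall n (u : BMW n.+1),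
     let s : braid n.+2 := @braid_gen n.+2 ord_max in
     t n.+1 (iota_BMW u * BMW_of s) = t n u /\
     t n.+1 (iota_BMW u * BMW_of s^-1%g) = t n u).

(* The Hecke algebra H_n(b,c). *)
Definition hecke_rel (n : nat) (u : RB n) : Prop :=
  exists i : 'I_n.-1, u = (RB_gen i - smap b) * (RB_gen i - smap c).

Definition Hecke (n : nat) := quor (@hecke_rel n).

(* BMW n and Hecke n are both quotients of RB n, so t factors through the
   projections BMW n -> Hecke n when each t n agrees on RB n with a linear map
   on Hecke n. *)
Definition factors_Hecke (M : lmodType R)
    (t : forall n, {linear BMW n.+1 -> M}) : Prop :=
  forall n, exists tau : {linear Hecke n.+1 -> M},
    forall u : RB n.+1, t n (to_BMW u) = tau (to_quor (@hecke_rel n.+1) u).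
End CubicAlgebras.

(* Q[a,b,c,(abc)^-1] *)
Definition Rabc := loc ('X_0 * 'X_1 * 'X_2 : {mpoly rat[3]}).
HB.instance Definition _ := GRing.ComPzRing.on Rabc.

Definition Ra : Rabc := to_loc _ 'X_0.
Definition Rb : Rabc := to_loc _ 'X_1.
Definition Rc : Rabc := to_loc _ 'X_2.
Definition Rx : Rabc := Rb + Rc.
Definition Ry : Rabc := Rb * Rc.

(* S = R[x^-1] *)
Definition Sx := loc Rx.
HB.instance Definition _ := GRing.ComPzRing.on Sx.
HB.instance Definition _ := GRing.Lmodule.on Sx.

(* S / (a^2 - y) *)
Definition Sdag := quor (fun u : Sx => u = to_loc Rx (Ra ^+ 2 - Ry)).
HB.instance Definition _ := GRing.ComPzRing.on Sdag.

Definition Sdag_y1 : Sdag := to_quor _ (to_loc Rx (Ry - 1)).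

(* (S / (a^2 - y))[(y - 1)^-1] *)
Definition Tdag := loc Sdag_y1.
HB.instance Definition _ := GRing.ComPzRing.on Tdag.

Definition S_to_T : {rmorphism Sx -> Tdag} :=
  (to_loc Sdag_y1 : {rmorphism Sdag -> Tdag}) \o
  (to_quor _ : {rmorphism Sx -> Sdag}).
Definition R_to_T : {rmorphism Rabc -> Tdag} :=
  S_to_T \o (to_loc Rx : {rmorphism Rabc -> Sx}).

Notation BMWabc := (BMW Ra Rb Rc).

Definition ocneanu_trace (t : forall n, {linear BMWabc n.+1 -> Sx}) : Prop :=
  [/\ markov_trace t, factors_Hecke t & t 0%N 1 = 1].

(* Main.v *)
Require Import Defs.
From HB Require Import structures.
From mathcomp Require Import all_boot all_order all_algebra.
From mathcomp Require Import ring.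

(* Only the Markov property and t^H_1(1) = 1 matter: the difference of t' and
   t^H m, with m = t'_1(1), is a Markov trace d with d_1(1) = 0, and such a d
   vanishes. Indeed the relation R_n and the cubic relation give
   BMW_(n+1) = BMW_n + BMW_n s_n BMW_n + BMW_n s_n^-1 BMW_n, so it is enough to
   see that d_n = 0 forces d_(n+1)(u) = 0 for u in BMW_n. Evaluating d_(n+2) at
   u R_n gives a linear relation between d_(n+1)(u) and d_(n+2)(u); the
   coefficient of d_(n+2)(u) is a multiple of a^2 - y, hence vanishes, and that
   of d_(n+1)(u) is x^2 (1 - y) up to a unit. *)

Set Implicit Arguments.
Unset Strict Implicit.
Unset Printing Implicit Defensive.

Import GRing.Theory.

Local Open Scope ring_scope.

(** * Elements satisfying the cubic relation *)

Section CubicElement.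
Variables (R : comPzRingType) (A : pzAlgType R).

(** Multiplying the cubic on the right by [s'] lowers each power of [s] by one, and the constant
    term becomes a multiple of [s']. *)
Lemma cubic_inv (a b c : R) (s s' : A) : s * s' = 1 ->
  (s - smap a) * (s - smap b) * (s - smap c) = 0 ->
  smap (a * b * c) * s' =
    s * s - smap (a + b + c) * s + smap (a * b + b * c + c * a).
Proof.
move=> ss' cub.
have quad k l : (s + smap k) * (s + smap l) =
    s * s + smap (k + l) * s + smap (k * l).
  by rewrite mulrDl !mulrDr -smapC rmorphD rmorphM mulrDl !addrA (addrAC (s * s)).
have quadV k l : (s * s + smap k * s + smap l) * s' = s + smap k + smap l * s'.
  by rewrite !mulrDl -!mulrA ss' !mulr1.
have expand : (s + smap (- a)) * (s + smap (- b)) * (s + smap (- c)) * s' =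
    s * s + smap (- (a + b + c)) * s + smap (a * b + b * c + c * a)
    + smap (- (a * b * c)) * s'.
  rewrite quad mulrDr -smapC mulrDl -(mulrA _ s) -(mulrA (smap (- c))) ss'.
  rewrite mulr1 quadV.
  have -> : - (a * b * c) = - c * (- a * - b) by ring.
  have -> : - (a + b + c) = (- a - b) + - c by ring.
  have -> : a * b + b * c + c * a = - a * - b + - c * (- a + - b) by ring.
  rewrite [smap (_ * (_ * _))]rmorphM (rmorphD _ _ (- c)) (rmorphD _ (- a * - b)).
  rewrite (rmorphM _ (- c)) mulrDl !mulrDr !addrA mulrA.
  by rewrite (addrAC _ (smap (- a * - b)) (smap (- c) * s)).
move: expand; rewrite !rmorphN cub mul0r !mulNr => /esym/eqP.
by rewrite subr_eq0 => /eqP/esym.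
Qed.

Lemma cubic_invX2 (a b c : R) (s s' : A) : s * s' = 1 ->
  (s - smap a) * (s - smap b) * (s - smap c) = 0 ->
  smap (a * b * c) * (s' * s') =
    s - smap (a + b + c) + smap (a * b + b * c + c * a) * s'.
Proof.
move=> ss' cub; rewrite mulrA (cubic_inv ss' cub) mulrDl mulrBl.
by rewrite -!(mulrA _ s s') ss' !mulr1.
Qed.

Lemma comm_smap r (u t : A) : u * t = t * u -> smap r * u * t = t * (smap r * u).
Proof. by move=> ut; rewrite -mulrA ut mulrA smapC mulrA. Qed.

Lemma comm_mul (u v t : A) : u * t = t * u -> v * t = t * v ->
  u * v * t = t * (u * v).
Proof. by move=> ut vt; rewrite -mulrA vt !mulrA ut. Qed.

Lemma comm_inverse (s s' u : A) :
  s * s' = 1 -> s' * s = 1 -> u * s = s * u -> u * s' = s' * u.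
Proof.
move=> ss' s's us; rewrite -[LHS]mul1r -s's -(mulrA s') (mulrA s) -us.
by rewrite -(mulrA u) ss' mulr1.
Qed.

End CubicElement.

(** * The braid relation with signs *)

Section BraidRelation.
Variables (A : pzRingType) (s s' t t' : A).
Hypotheses (ss' : s * s' = 1) (s's : s' * s = 1).
Hypotheses (tt' : t * t' = 1) (t't : t' * t = 1).
Hypothesis sts : s * t * s = t * s * t.

Lemma braid_tsV : t * s * t' = s' * t * s.
Proof.
rewrite -[LHS]mul1r -s's -!mulrA; congr (_ * _); rewrite !mulrA sts.
by rewrite -[LHS]mulrA tt' mulr1.
Qed.

Lemma braid_Vst : t' * s * t = s * t * s'.
Proof.
rewrite -[RHS]mul1r -t't -!mulrA; congr (_ * _); rewrite !mulrA -sts.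
by rewrite -[RHS]mulrA ss' mulr1.
Qed.

Lemma braid_tVV : t * s' * t' = s' * t' * s.
Proof.
rewrite -[RHS]mulr1 -tt' !mulrA -(mulrA _ s t) -(mulrA _ t') (mulrA t').
by rewrite braid_Vst !mulrA s's mul1r.
Qed.

Lemma braid_VVt : t' * s' * t = s * t' * s'.
Proof.
rewrite -[LHS]mulr1 -ss' !mulrA -(mulrA _ t s) -(mulrA t') (mulrA s').
by rewrite -braid_tsV !mulrA t't mul1r.
Qed.

Lemma braid_VVV : t' * s' * t' = s' * t' * s'.
Proof.
rewrite -[RHS]mulr1 -tt' !mulrA -(mulrA s') -(mulrA s') braid_VVt.
by rewrite !mulrA s's mul1r.
Qed.
End BraidRelation.

(** * The relation R_i on three strands *)

(** This is R_i with [s], [t] for s_i, s_(i+1) and [s'], [t'] for their inverses, read in an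
    arbitrary algebra so that the computations stay away from the quotients. *)
Definition bmw_expr (R : comPzRingType) (b c : R) (A : pzAlgType R)
    (s s' t t' : A) : A :=
  let x := b + c in let y := b * c in
  - (smap y * (s * t' * s)) + smap (y ^+ 2) * (t' * s * t')
    - s * t * s - smap (x * y ^+ 2) * (t' ^+ 2) + smap x * s ^+ 2
    + smap (y ^+ 3) * (t' * s' * t').

Section ThreeStrands.
Variables (R : comPzRingType) (a b c k : R) (A : pzAlgType R) (s s' t t' : A).
Hypothesis kabc : k * (a * b * c) = 1.
Hypotheses (ss' : s * s' = 1) (s's : s' * s = 1).
Hypotheses (tt' : t * t' = 1) (t't : t' * t = 1).
Hypothesis cub_t : (t - smap a) * (t - smap b) * (t - smap c) = 0.
Hypothesis sts : s * t * s = t * s * t.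
Hypothesis bmw : bmw_expr b c s s' t t' = 0.

Section Span.
Variable P : A -> Prop.
Hypothesis PD : forall u v, P u -> P v -> P (u + v).
Hypothesis PZ : forall r u, P u -> P (smap r * u).

Let PN u : P u -> P (- u).
Proof. by move=> Pu; rewrite -mulN1r -(rmorphN1 smap); apply: PZ. Qed.

Let PB u v : P u -> P v -> P (u - v).
Proof. by move=> Pu Pv; apply/PD/PN. Qed.

Let PZK r r' u : r' * r = 1 -> P (smap r * u) -> P u.
Proof.
by move=> r'r /(PZ r'); rewrite mulrA -rmorphM r'r rmorph1 mul1r.
Qed.

(** By the cubic relation t^2 is a combination of 1, t and t^-1. The predicate [P] is instantiated
    by [span] below. *)
Lemma square_span : P 1 -> P t -> P t' -> P (t * t).
Proof.
move=> P1 Pt Pt'.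
rewrite -(subrK (smap (a + b + c) * t) (t * t)).
rewrite -(addrK (smap (a * b + b * c + c * a)) (_ - _)) -(cubic_inv tt' cub_t).
by apply: PD (PB (PZ _ Pt') _) (PZ _ Pt); rewrite -[smap _]mulr1; apply: PZ.
Qed.

Lemma square_inv_span : P 1 -> P t -> P t' -> P (t' * t').
Proof.
move=> P1 Pt Pt'; apply: PZK kabc _; rewrite (cubic_invX2 tt' cub_t).
by apply: PD (PB Pt _) (PZ _ Pt'); rewrite -[smap _]mulr1; apply: PZ.
Qed.

Hypotheses (Psl : forall u, P u -> P (s * u)) (Ps'l : forall u, P u -> P (s' * u)).
Hypotheses (Psr : forall u, P u -> P (u * s)) (Ps'r : forall u, P u -> P (u * s')).
Hypotheses (P1 : P 1) (Pt : P t) (Pt' : P t').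

(** R_i expresses y^2 t^-1 s t^-1 through s t^-1 s, s t s, t^-2, s^2 and t^-1 s^-1 t^-1 = s^-1 t^-1
    s^-1. Since y divides the unit abc, y^2 can be cancelled. *)
Lemma span_VsV : P (t' * s * t').
Proof.
have yK : (k * a) ^+ 2 * (b * c) ^+ 2 = 1.
  by rewrite -exprMn -(mulrA k) (mulrA a) kabc expr1n.
apply: PZK yK _; move: bmw; rewrite /bmw_expr -!addrA addrCA => /eqP.
rewrite addr_eq0 => /eqP ->.
apply/PN/PD; first by apply/PN/PZ/Psr/Psl.
apply/PD; first by apply/PN/Psr/Psl.
apply/PD; first by apply/PN/PZ; rewrite expr2; apply: square_inv_span.
apply/PD; first by apply/PZ; rewrite expr2 -[s * s]mulr1 -mulrA; apply/Psl/Psl.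
by rewrite (braid_VVV ss' s's tt' t't sts); apply/PZ/Ps'r/Ps'l.
Qed.

(* Substitute the cubic expression of t^-1 for the first factor of t^-1 s t^-1
   and use t s t^-1 = s^-1 t s. *)
Lemma span_tVt : P (t * s' * t).
Proof.
have /(PZ (a * b * c)) := span_VsV.
rewrite -(mulrA t') (mulrA (smap _)) (cubic_inv tt' cub_t) mulrDl mulrBl => Ptt.
have {}Ptt : P (t * t * (s * t')).
  rewrite -(subrK (smap (a + b + c) * t * (s * t')) (t * t * _)).
  rewrite -(addrK (smap (a * b + b * c + c * a) * (s * t')) (_ - _)).
  apply: PD; first by apply: PB Ptt _; apply/PZ/Psl.
  by rewrite -mulrA (mulrA t) (braid_tsV s's tt' sts); apply/PZ/Psr/Ps'l.
(* Here t t s t^-1 = t s^-1 t s, and the final s is removed by s^-1. *)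
move: Ptt; rewrite -mulrA (mulrA t s) (braid_tsV s's tt' sts) !mulrA => /Ps'r.
by rewrite -mulrA ss' mulr1.
Qed.
End Span.
End ThreeStrands.

(** * Evaluating a trace on u R_i *)

Section Trace.
Variables (R : comPzRingType) (a b c : R) (A : pzAlgType R).
Variables (T : comPzRingType) (phi : {rmorphism R -> T}) (N : lmodType T).
Variable D : A -> N.
Hypothesis DD : forall u v, D (u + v) = D u + D v.
Hypothesis DZ : forall r u, D (smap r * u) = phi r *: D u.
Hypothesis Dtr : forall u v, D (u * v) = D (v * u).

Let DN u : D (- u) = - D u.
Proof. by rewrite -mulN1r -(rmorphN1 smap) DZ rmorphN1 scaleN1r. Qed.

Let DZr r u v : D (u * (smap r * v)) = phi r *: D (u * v).
Proof. by rewrite mulrA -smapC -mulrA DZ. Qed.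

Let e1 := phi (a + b + c).
Let e2 := phi (a * b + b * c + c * a).
Let e3 := phi (a * b * c).

Lemma trace_square (u s s' : A) : s * s' = 1 ->
    (s - smap a) * (s - smap b) * (s - smap c) = 0 ->
  D (u * (s * s)) = e3 *: D (u * s') + e1 *: D (u * s) - e2 *: D u.
Proof.
move=> ss' cub; rewrite -DZr (cubic_inv ss' cub) mulrDr mulrBr !(DD, DN).
rewrite -(mulr1 (smap (a * b + b * c + c * a))) !DZr.
by rewrite mulr1 addrAC addrK subrK.
Qed.

Lemma trace_square_inv (u s s' : A) : s * s' = 1 ->
    (s - smap a) * (s - smap b) * (s - smap c) = 0 ->
  e3 *: D (u * (s' * s')) = D (u * s) - e1 *: D u + e2 *: D (u * s').
Proof.
move=> ss' cub; rewrite -DZr (cubic_invX2 ss' cub) mulrDr mulrBr !(DD, DN).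
by rewrite -(mulr1 (smap (a + b + c))) !DZr mulr1.
Qed.

Variables (s s' t t' u : A) (z : N).
Let x := b + c.
Let y := b * c.
Hypotheses (ss' : s * s' = 1) (tt' : t * t' = 1).
Hypothesis cub_s : (s - smap a) * (s - smap b) * (s - smap c) = 0.
Hypothesis cub_t : (t - smap a) * (t - smap b) * (t - smap c) = 0.
Hypothesis bmw : bmw_expr b c s s' t t' = 0.
Hypothesis ut' : u * t' = t' * u.
Hypotheses (Dt : D (u * t) = z) (Dt' : D (u * t') = z).
Hypotheses (Ds : D (u * s) = z) (Ds' : D (u * s') = z).
Hypotheses (Dst : D (u * s * t) = 0) (Dst' : D (u * s * t') = 0).
Hypotheses (Ds't : D (u * s' * t) = 0) (Ds't' : D (u * s' * t') = 0).
Hypotheses (Dsts : D (u * (s * t * s)) = - e2 *: z).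
Hypotheses (Dst's : D (u * (s * t' * s)) = - e2 *: z).
Hypothesis a2 : phi (a ^+ 2) = phi y.

(** The hypotheses evaluate e3 D(u R_i) = 0 as a combination of [z] and [D u]. The coefficient of
    [D u] is x^2 y (y - a^2), which vanishes; that of [z] reduces to e3 x^2 (1 - y) once a^2 = y. *)
Lemma trace_bmw : (e3 * (phi x ^+ 2 * (1 - phi y))) *: z = 0.
Proof.
have Dss := trace_square u ss' cub_s.
have p := trace_square_inv u tt' cub_t.
(* Since [u] commutes with [t'], cyclicity brings the two factors [t'] together. *)
have VwV w : D (u * (t' * w * t')) = D (u * w * (t' * t')).
  by rewrite !mulrA ut' -!mulrA Dtr !mulrA.
have q1 := trace_square_inv (u * s) tt' cub_t.
have q2 := trace_square_inv (u * s') tt' cub_t.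
rewrite Dt Dt' in p; rewrite Ds Ds' in Dss.
rewrite Dst Dst' Ds in q1; rewrite Ds't Ds't' Ds' in q2.
(* The factor e3 is there because the values at t^-2 are known only after multiplication by e3. *)
have /(congr1 (fun w => e3 *: D (u * w))) := bmw.
rewrite /bmw_expr !expr2 !mulrDr !mulrN !(DD, DN, DZr) mulr0 -(mul0r 0).
rewrite -(rmorph0 smap) DZ rmorph0 scale0r scaler0 !VwV Dsts Dst's Dss.
rewrite !(scalerDr, scalerN) !(scalerA e3) !(mulrC e3) -!(scalerA _ e3).
rewrite p q1 q2.
(* [L p q] records the coefficients of z and D u, which turns the goal into a
   ring identity for each of them. *)
pose L p' q' := p' *: z + q' *: D u.
have LD p1 p2 r1 r2 : L p1 r1 + L p2 r2 = L (p1 + p2) (r1 + r2).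
  by rewrite /L !scalerDl addrACA.
have LN p1 r1 : - L p1 r1 = L (- p1) (- r1) by rewrite /L !scaleNr opprD.
have LZ w p1 r1 : w *: L p1 r1 = L (w * p1) (w * r1).
  by rewrite /L scalerDr !scalerA.
have zE : z = L 1 0 by rewrite /L scale1r scale0r addr0.
have uE : D u = L 0 1 by rewrite /L scale1r scale0r add0r.
have E0 : 0 = L 0 0 by rewrite /L !scale0r addr0.
rewrite {}zE {}uE E0 !(LZ, LN, LD) => rel; rewrite -[RHS]rel; congr L.
all: move: a2; rewrite /e1 /e2 /e3 /x /y !(rmorphXn, rmorphD, rmorphM) /= => h.
all: by ring: h.
Qed.
End Trace.

(** * The tower of algebras and its bimodule decomposition *)

(* [A n] stands for the algebra on n + 1 strands and [sigma i true] for the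
   inverse of [sigma i false]. *)
Section Tower.
Variables (R : comPzRingType) (a b c k : R) (A : nat -> pzAlgType R).
Variables (iota : forall n, A n -> A n.+1) (sigma : forall n, 'I_n -> bool -> A n).
Arguments iota {n}.
Arguments sigma {n}.
Hypothesis kabc : k * (a * b * c) = 1.
Hypothesis iota1 : forall n, iota 1 = 1 :> A n.+1.
Hypothesis iotaD : forall n (u v : A n), iota (u + v) = iota u + iota v.
Hypothesis iotaM : forall n (u v : A n), iota (u * v) = iota u * iota v.
Hypothesis iota_smap : forall n r, iota (smap r : A n) = smap r.
Hypothesis iota_sigma : forall n (i : 'I_n) e,
  iota (sigma i e) = sigma (widen_ord (leqnSn n) i) e.
Hypothesis sigmaK : forall n (i : 'I_n) e, sigma i e * sigma i (~~ e) = 1.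
Hypothesis sigma_cubic : forall n (i : 'I_n) (s := sigma i false),
  (s - smap a) * (s - smap b) * (s - smap c) = 0.
Hypothesis sigma_far : forall n (i j : 'I_n), (i.+1 < j)%N ->
  sigma i false * sigma j false = sigma j false * sigma i false.
Hypothesis sigma_near : forall n (i j : 'I_n), i.+1 = j ->
  sigma i false * sigma j false * sigma i false =
  sigma j false * sigma i false * sigma j false.
Hypothesis sigma_bmw : forall n (i j : 'I_n), i.+1 = j ->
  let s := sigma i false in let s' := sigma i true in
  let t := sigma j false in let t' := sigma j true in
  bmw_expr b c s s' t t' = 0.
Hypothesis A_ind : forall n (P : A n -> Prop), P 1 ->
  (forall u v, P u -> P v -> P (u + v)) ->
  (forall r u, P u -> P (smap r * u)) ->
  (forall i e u, P u -> P (u * sigma i e)) -> forall u, P u.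

Let g n e : A n.+1 := sigma ord_max e.

Let gK n e : g n e * g n (~~ e) = 1. Proof. exact: sigmaK. Qed.

Let g_cubic n (s := g n false) :
  (s - smap a) * (s - smap b) * (s - smap c) = 0.
Proof. exact: sigma_cubic. Qed.

Let iota_g n e : iota (g n e) = sigma (widen_ord (leqnSn n.+1) ord_max) e.
Proof. exact: iota_sigma. Qed.

Let g_near n : iota (g n false) * g n.+1 false * iota (g n false) =
  g n.+1 false * iota (g n false) * g n.+1 false.
Proof. by rewrite iota_g; apply: sigma_near. Qed.

Let g_bmw n :
  let s := iota (g n false) in let s' := iota (g n true) in
  let t := g n.+1 false in let t' := g n.+1 true in
  bmw_expr b c s s' t t' = 0.
Proof. by rewrite /= !iota_g; apply: sigma_bmw. Qed.

(** The element [u] involves generators of index below [n], at distance at least two from index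
    [n.+1]. *)
Let g_far n (u : A n) e : iota (iota u) * g n.+1 e = g n.+1 e * iota (iota u).
Proof.
elim/A_ind: u => [|u v hu hv|r u hu|i e' u hu].
- by rewrite !iota1 mul1r mulr1.
- by rewrite !iotaD mulrDl mulrDr hu hv.
- by rewrite !iotaM !iota_smap; apply: comm_smap.
rewrite 2!iotaM; apply: comm_mul hu _; rewrite !iota_sigma /g.
set j : 'I_n.+2 := widen_ord _ _; set l : 'I_n.+2 := ord_max.
have jl : sigma j false * sigma l false = sigma l false * sigma j false.
  by apply: sigma_far; rewrite /= ltnS; apply: ltn_ord.
have jl' : sigma l false * sigma j e' = sigma j e' * sigma l false.
  case: e'; last by rewrite jl.
  exact: comm_inverse (sigmaK j false) (sigmaK j true) (esym jl).
case: e; last by rewrite jl'.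
exact: comm_inverse (sigmaK l false) (sigmaK l true) (esym jl').
Qed.

Lemma tower0_scalar (u : A 0) : exists r, u = smap r.
Proof.
elim/A_ind: u => [|_ _ [r ->] [r' ->]|r _ [r' ->]|[]//].
- by exists 1; rewrite rmorph1.
- by exists (r + r'); rewrite rmorphD.
- by exists (r * r'); rewrite rmorphM.
Qed.

(** Scalars and all generators but the last come from [A n]. *)
Lemma tower_ind n (P : A n.+1 -> Prop) : P 1 ->
  (forall u v, P u -> P v -> P (u + v)) ->
  (forall u v, P u -> P (u * iota v)) ->
  (forall u e, P u -> P (u * g n e)) -> forall u, P u.
Proof.
move=> P1 PD Pi Pg; elim/A_ind=> // [r u|i e u] Pu.
  by rewrite smapC -iota_smap; apply: Pi.
have [j ->|->] := unliftP (ord_max : 'I_n.+1) i; last exact: Pg.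
rewrite (_ : lift _ _ = widen_ord (leqnSn n) j); last exact/val_inj/lift_max.
by rewrite -iota_sigma; apply: Pi.
Qed.

(** The sub-bimodule A_n + A_n g A_n + A_n g^-1 A_n of A_(n+1), on which scalars act through A_n. *)
Inductive span n : A n.+1 -> Prop :=
| span_iota u : span (iota u)
| span_gen u e v : span (iota u * g n e * iota v)
| spanD u v : span u -> span v -> span (u + v).

Lemma span_mull n (u : A n) v : span v -> span (iota u * v).
Proof.
elim=> [w|w e w'|w w' _ hw _ hw'].
- by rewrite -iotaM; apply: span_iota.
- by rewrite !mulrA -iotaM; apply: span_gen.
- by rewrite mulrDr; apply: spanD.
Qed.

Lemma span_mulr n (u : A n) v : span v -> span (v * iota u).
Proof.
elim=> [w|w e w'|w w' _ hw _ hw'].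
- by rewrite -iotaM; apply: span_iota.
- by rewrite -mulrA -iotaM; apply: span_gen.
- by rewrite mulrDl; apply: spanD.
Qed.

Lemma span_smap n r (v : A n.+1) : span v -> span (smap r * v).
Proof. by rewrite -iota_smap; apply: span_mull. Qed.

Lemma span1 n : @span n 1.
Proof. by rewrite -iota1; apply: span_iota. Qed.

Lemma span_g n e : span (g n e).
Proof. by have := span_gen (1 : A n) e 1; rewrite iota1 mul1r mulr1. Qed.

Lemma span_gg n e f : span (g n e * g n f).
Proof.
have gg1 e' : span (g n e' * g n (~~ e')) by rewrite gK; apply: span1.
have [[P1 Pt] Pt'] := (span1 n, span_g n false, span_g n true).
case: e; case: f.
- exact (square_inv_span kabc (gK _ false) (g_cubic n)
    (@spanD n) (@span_smap n) P1 Pt Pt').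
- exact: (gg1 true).
- exact: (gg1 false).
- exact (square_span (gK _ false) (g_cubic n)
    (@spanD n) (@span_smap n) P1 Pt Pt').
Qed.

Let iK n e : iota (g n e) * iota (g n (~~ e)) = 1.
Proof. by rewrite -iotaM gK iota1. Qed.

(** In six of the eight sign patterns the braid relation leaves a single letter [g n.+1] or its
    inverse; t^-1 s t^-1 and t s^-1 t are the two that require R_i. *)
Lemma span_ggg n e f h :
  span (g n.+1 e * iota (g n f) * g n.+1 h).
Proof.
have ss' := iK n false; have s's := iK n true.
have tt' := gK n.+1 false; have t't := gK n.+1 true.
have sts := g_near n.
have Pl f' := span_mull (g n f').
have Pr f' := span_mulr (g n f').
have [[P1 Pt] Pt'] := (span1 n.+1, span_g n.+1 false, span_g n.+1 true).
case: e; case: f; case: h.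
- by rewrite (braid_VVV ss' s's tt' t't sts); apply/Pr/Pl.
- by rewrite (braid_VVt ss' s's tt' t't sts); apply/Pr/Pl.
- exact (span_VsV kabc ss' s's tt' t't (g_cubic n.+1) sts (g_bmw n)
    (@spanD _) (@span_smap _) (Pl false) (Pl true) (Pr false) (Pr true) P1 Pt Pt').
- by rewrite (braid_Vst ss' t't sts); apply/Pr/Pl.
- by rewrite (braid_tVV ss' s's tt' t't sts); apply/Pr/Pl.
- exact (span_tVt kabc ss' s's tt' t't (g_cubic n.+1) sts (g_bmw n)
    (@spanD _) (@span_smap _) (Pl false) (Pl true) (Pr false) (Pr true) P1 Pt Pt').
- by rewrite (braid_tsV s's tt' sts); apply/Pr/Pl.
- by rewrite -sts; apply/Pr/Pl.
Qed.

(** The point is closure under right multiplication by g^e. In v g^f w g^e the middle factor [w] is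
    decomposed by induction; what comes from two levels below commutes with [g], which leaves g^f
    g^e or a product treated by [span_ggg]. *)
Lemma spanT n u : @span n u.
Proof.
elim: n u => [|n IHn] u; elim/tower_ind: u => [|u v hu hv|u v hu|u e hu].
(* The goals are the four conditions of [tower_ind] for n = 0, then the same four for the inductive
   step; each line settles one condition in both cases. *)
1, 5: exact: span1.
1, 4: exact: spanD.
1, 3: exact: span_mulr.
all: elim: hu => [v|v f w|v v' _ hv _ hv']; last by rewrite mulrDl; apply: spanD.
- exact/span_mull/span_g.
(* For n = 0 the middle factor is a scalar, so the two powers of [g] meet. *)
- have [r ->] := tower0_scalar w; rewrite iota_smap -smapC -iota_smap -!mulrA.
  by do 2!apply: span_mull; apply: span_gg.
- exact/span_mull/span_g.
rewrite -!mulrA; apply: span_mull; rewrite mulrA.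
elim: (IHn w) => [w'|w1 f' w2|w1 w2 _ h1 _ h2].
- by rewrite -g_far -mulrA; apply/span_mull/span_gg.
- rewrite !iotaM -!mulrA g_far !mulrA -g_far -!mulrA; apply: span_mull.
  by rewrite !mulrA; apply/span_mulr/span_ggg.
by rewrite iotaD mulrDr mulrDl; apply: spanD.
Qed.

Let i_cubic n (s := iota (g n false)) :
  (s - smap a) * (s - smap b) * (s - smap c) = 0.
Proof.
rewrite /s -!rmorphN -!iota_smap -!iotaD -!iotaM !iota_smap !rmorphN g_cubic.
by rewrite -(rmorph0 smap) iota_smap rmorph0.
Qed.

(** * Vanishing of a Markov trace that is zero at 1 *)

Section Trace.
Variables (T : comPzRingType) (phi : {rmorphism R -> T}) (N : lmodType T).
Variables (d : forall n, A n -> N) (w : T).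
Arguments d {n}.
Hypothesis dD : forall n (u v : A n), d (u + v) = d u + d v.
Hypothesis dZ : forall n r (u : A n), d (smap r * u) = phi r *: d u.
Hypothesis dC : forall n (u v : A n), d (u * v) = d (v * u).
Hypothesis dg : forall n (u : A n) e, d (iota u * g n e) = d u.
Hypothesis a2 : phi (a ^+ 2) = phi (b * c).
Hypothesis wK :
  w * (phi (a * b * c) * (phi (b + c) ^+ 2 * (1 - phi (b * c)))) = 1.

(* Conjugation by the last two generators moves the unlinked strand past
   the last strand of [u]. *)
Lemma trace_iota_g n (u : A n) e :
  d (iota (iota u) * iota (g n e)) = d (iota u).
Proof.
have ss' := iK n false; have s's := iK n true.
have tt' := gK n.+1 false; have t't := gK n.+1 true.
have sts := g_near n.
have conj : g n.+1 false * iota (g n e) * g n.+1 true =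
    iota (g n true) * g n.+1 e * iota (g n false).
  case: (e); first exact (braid_tVV ss' s's tt' t't sts).
  exact (braid_tsV s's tt' sts).
rewrite -[LHS](congr1 _ (mulr1 _)) -t't mulrA dC !mulrA -g_far.
rewrite -(mulrA _ (g _ false)) -(mulrA _ _ (g _ true)) conj.
rewrite !mulrA dC !mulrA -!iotaM dg -mulrA dC -mulrA.
by rewrite (gK n true) mulr1.
Qed.

(** Apply [trace_bmw] with [z] equal to [d (iota u)]. The Markov property takes the products u s^e
    t^f down to [A n], where [d] is zero, and u s t^e s to u s^2, of which only the term -e2 z
    survives. *)
Lemma trace_iota n (u : A n) : (forall v : A n, d v = 0) -> d (iota u) = 0.
Proof.
move=> d0.
have sgs e : d (iota (iota u) * (iota (g n false) * g n.+1 e * iota (g n false)))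
    = - phi (a * b + b * c + c * a) *: d (iota u).
  rewrite mulrA dC !mulrA -!iotaM dg -mulrA dC -mulrA.
  rewrite (trace_square (@dD _) (@dZ _) _ (gK _ false) (g_cubic n)).
  by rewrite !dg d0 !scaler0 add0r sub0r scaleNr.
have sg e f : d (iota (iota u) * iota (g n e) * g n.+1 f) = 0.
  by rewrite -iotaM !dg d0.
(* The scalar [w] inverts the coefficient of [z] in [trace_bmw]. *)
rewrite -[LHS]scale1r -wK -scalerA.
rewrite (trace_bmw (@dD _) (@dZ _) (@dC _) (iK n false) (gK n.+1 false) (i_cubic n)
  (g_cubic n.+1) (g_bmw n) (g_far u true) (dg _ _) (dg _ _) (trace_iota_g u _)
  (trace_iota_g u _) (sg _ _) (sg _ _) (sg _ _) (sg _ _) (sgs _) (sgs _) a2).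
exact: scaler0.
Qed.

(** Induction along the tower: by cyclicity and the Markov property, [d] takes at u g^e v its value
    at v u, one level down. *)
Lemma trace_eq0 n (u : A n) : d (1 : A 0) = 0 -> d u = 0.
Proof.
move=> d1; elim: n u => [u|n IHn u].
  by have [r ->] := tower0_scalar u; rewrite -[smap r]mulr1 dZ d1 scaler0.
elim: (spanT u) => [{}u|{}u e v|v v' _ hv _ hv'].
- exact: trace_iota.
- by rewrite dC mulrA -iotaM dg.
- by rewrite dD hv hv' addr0.
Qed.
End Trace.
End Tower.

(** * The algebras BMW_n as a tower *)

Lemma braid_wordM n (u v : seq ('I_n.-1 * bool)) :
  (prg_word (@braid_rel n.-1) u * prg_word (@braid_rel n.-1) v)%g =
  prg_word (@braid_rel n.-1) (u ++ v).
Proof. exact: prg_mulE. Qed.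

Lemma braid_gen_far n (i j : 'I_n.-1) : (i.+1 < j)%N ->
  (braid_gen i * braid_gen j = braid_gen j * braid_gen i)%g.
Proof.
move=> ij; rewrite /braid_gen /prg_gen !braid_wordM; apply/prg_wordP.
exact: (wcong_rel [::] [::] (braid_far ij)).
Qed.

Lemma braid_gen_near n (i j : 'I_n.-1) : i.+1 = j ->
  (braid_gen i * braid_gen j * braid_gen i =
   braid_gen j * braid_gen i * braid_gen j)%g.
Proof.
move=> ij; rewrite /braid_gen /prg_gen !(braid_wordM [:: _] [:: _]).
rewrite !(braid_wordM [:: _; _]); apply/prg_wordP.
exact: (wcong_rel [::] [::] (braid_near ij)).
Qed.

(* Rewriting with [rmorphM] and the like in towers of quotients is very slow;
   these instances at a fixed map are cheap. *)
Section QuotientMorphism.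
Variables (A : pzRingType) (X : A -> Prop).
Implicit Types u v : A.

Lemma to_quorD u v : to_quor X (u + v) = to_quor X u + to_quor X v.
Proof. exact: rmorphD. Qed.

Lemma to_quorN u : to_quor X (- u) = - to_quor X u.
Proof. exact: rmorphN. Qed.

Lemma to_quorM u v : to_quor X (u * v) = to_quor X u * to_quor X v.
Proof. exact: rmorphM. Qed.

Lemma to_quor1 : to_quor X 1 = 1.
Proof. exact: rmorph1. Qed.
End QuotientMorphism.

Section BMW.
Variables (R : comPzRingType) (a b c : R).
Local Notation A := (BMW a b c).
Local Notation iota := (@iota_BMW _ a b c _).

Definition sgen n (i : 'I_n.-1) (e : bool) : A n :=
  BMW_of a b c (if e then (braid_gen i)^-1%g else braid_gen i).

Lemma to_BMWM n (u v : RB R n) :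
  to_BMW a b c (u * v) = to_BMW a b c u * to_BMW a b c v.
Proof. by rewrite /to_BMW !to_quorM. Qed.

Lemma to_BMWD n (u v : RB R n) :
  to_BMW a b c (u + v) = to_BMW a b c u + to_BMW a b c v.
Proof. by rewrite /to_BMW !to_quorD. Qed.

Lemma to_BMWZ n r (u : RB R n) :
  to_BMW a b c (smap r * u) = smap r * to_BMW a b c u.
Proof. exact: to_BMWM. Qed.

Lemma BMW_ofM n (g h : braid n) :
  BMW_of a b c (g * h)%g = BMW_of a b c g * BMW_of a b c h.
Proof. by rewrite /BMW_of gr_eltM to_BMWM. Qed.

Lemma BMW_of1 n : BMW_of a b c (1%g : braid n) = 1.
Proof. by rewrite /BMW_of gr_elt1 /to_BMW !to_quor1. Qed.

Lemma sgenK n (i : 'I_n.-1) e : sgen i e * sgen i (~~ e) = 1.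
Proof. by case: e; rewrite /sgen -BMW_ofM ?mulgV ?mulVg BMW_of1. Qed.

Lemma sgen_cubic n (i : 'I_n.-1) :
  (sgen i false - smap a) * (sgen i false - smap b) * (sgen i false - smap c) = 0.
Proof.
have /to_quor_eq0 h : ideal_gen (@cubic_rel R a b c n)
    ((RB_gen R i - smap a) * (RB_gen R i - smap b) * (RB_gen R i - smap c)).
  by apply: ideal_gen_in; exists i.
have := congr1 (to_quor (@bmw_rel R a b c n)) h.
by rewrite !to_quorM !to_quorD !to_quorN => ->; apply: rmorph0.
Qed.

Lemma sgen_bmw n (i j : 'I_n.-1) : i.+1 = j ->
  let s := sgen i false in let s' := sgen i true in
  let t := sgen j false in let t' := sgen j true in
  bmw_expr b c s s' t t' = 0.
Proof.
move=> ij; cbv zeta.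
have /to_quor_eq0 : ideal_gen (@bmw_rel R a b c n) (bmw_elt a b c i j).
  by apply: ideal_gen_in; exists i, j.
rewrite /bmw_elt /bmw_expr !quor_scaleE.
by rewrite !to_quorD !to_quorN !to_quorM.
Qed.

Lemma sgen_far n (i j : 'I_n.-1) : (i.+1 < j)%N ->
  sgen i false * sgen j false = sgen j false * sgen i false.
Proof. by move=> ij; rewrite /sgen -!BMW_ofM braid_gen_far. Qed.

Lemma sgen_near n (i j : 'I_n.-1) : i.+1 = j ->
  sgen i false * sgen j false * sgen i false =
  sgen j false * sgen i false * sgen j false.
Proof. by move=> ij; rewrite /sgen -!BMW_ofM braid_gen_near. Qed.

(** BMW_n is spanned by images of braids, and a braid is a word in the generators and their
    inverses, built up here from its last letter. *)
Lemma BMW_ind n (P : A n -> Prop) : P 1 -> (forall u v, P u -> P v -> P (u + v)) ->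
  (forall r u, P u -> P (smap r * u)) ->
  (forall i e u, P u -> P (u * sgen i e)) -> forall u, P u.
Proof.
move=> P1 PD PZ Pg; elim/quor_ind=> u; elim/quor_ind: u => u.
rewrite -[to_quor _ _]/(to_BMW a b c u).
elim/gr_ind: u => [|u v Pu Pv|r g]; last 1 first.
- have -> : gr_term r g = smap r * gr_elt R g :> RB R n.
    by rewrite -[RHS]/(gr_mul _ _) gr_mulUU mulr1 mul1g.
  rewrite to_BMWZ; apply: PZ; elim/prg_ind: g.
  elim/last_ind=> [|w [i e] Pw]; first by rewrite -(BMW_of1 n) in P1.
  have := Pg i e _ Pw; rewrite -BMW_ofM; congr P; congr to_BMW; congr gr_elt.
  rewrite -cats1 -braid_wordM; congr (_ * _)%g; case: e => //.
  exact: prg_invE.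
- have -> : 0 = smap 0 * gr_elt R 1%g :> RB R n by rewrite rmorph0 mul0r.
  by rewrite to_BMWZ; apply: PZ; have := P1; rewrite -(BMW_of1 n).
- by rewrite to_BMWD; apply: PD.
Qed.

Lemma iota_sgen n (i : 'I_n) e :
  iota (@sgen n.+1 i e) = @sgen n.+2 (widen_ord (leqnSn n) i) e.
Proof.
by case: e; rewrite /sgen /BMW_of iota_BMWE RB_incl_elt ?braid_inclV braid_incl_gen.
Qed.

Lemma iotaM n (u v : A n.+1) : iota (u * v) = iota u * iota v.
Proof. exact: rmorphM. Qed.

Lemma iotaD n (u v : A n.+1) : iota (u + v) = iota u + iota v.
Proof. exact: rmorphD. Qed.

Lemma iota1 n : iota 1 = 1 :> A n.+2.
Proof. exact: rmorph1. Qed.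

Lemma iota_smap n r : iota (smap r : A n.+1) = smap r.
Proof. by rewrite -[smap r]/(to_BMW a b c (smap r)) iota_BMWE RB_incl_smap. Qed.

Section Trace.
Variables (k : R) (T : comPzRingType) (phi : {rmorphism R -> T}) (N : lmodType T).
Variables (d : forall n, A n.+1 -> N) (w : T).
Arguments d {n}.
Hypothesis kabc : k * (a * b * c) = 1.
Hypothesis dD : forall n (u v : A n.+1), d (u + v) = d u + d v.
Hypothesis dZ : forall n r (u : A n.+1), d (smap r * u) = phi r *: d u.
Hypothesis dC : forall n (u v : A n.+1), d (u * v) = d (v * u).
Hypothesis dg : forall n (u : A n.+1) e, d (iota u * @sgen n.+2 ord_max e) = d u.
Hypothesis a2 : phi (a ^+ 2) = phi (b * c).
Hypothesis wK :
  w * (phi (a * b * c) * (phi (b + c) ^+ 2 * (1 - phi (b * c)))) = 1.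

Lemma BMW_trace_eq0 n (u : A n.+1) : d (1 : A 1) = 0 -> d u = 0.
Proof.
move=> d1.
apply: (@trace_eq0 R a b c k (fun n => A n.+1) (fun n => @iota_BMW R a b c n)
  (fun n => @sgen n.+1) kabc iota1 iotaD iotaM iota_smap iota_sgen
  (fun n => @sgenK n.+1) (fun n => @sgen_cubic n.+1) (fun n => @sgen_far n.+1)
  (fun n => @sgen_near n.+1) (fun n => @sgen_bmw n.+1) (fun n => @BMW_ind n.+1)
  T phi N (@d) w dD dZ dC dg a2 wK n u d1).
Qed.
End Trace.
End BMW.

(** * Units of the coefficient ring and the conclusion *)

Lemma frac1K (A : comPzRingType) (f : A) : Defs.frac f 1 1 * to_loc f f = 1.
Proof. by rewrite -[to_loc f f]expr1 fracE rmorph1. Qed.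

Lemma Rabc_unit : exists k : Rabc, k * (Ra * Rb * Rc) = 1.
Proof. by exists (Defs.frac _ 1 1); rewrite -!rmorphM frac1K. Qed.

Lemma Tdag_a2 : R_to_T (Ra ^+ 2) = R_to_T (Rb * Rc).
Proof.
apply/eqP; rewrite -subr_eq0 -rmorphB; apply/eqP.
have /to_quor_eq0 h : ideal_gen (fun u : Sx => u = to_loc Rx (Ra ^+ 2 - Ry))
  (to_loc Rx (Ra ^+ 2 - Ry)) by apply: ideal_gen_in.
by rewrite -[LHS]/(to_loc Sdag_y1 (to_quor _ _)) h rmorph0.
Qed.

(** Each factor was inverted at one stage: abc in R, x in S, y - 1 in the last localization. The
    sign of [y'] accounts for 1 - y. *)
Lemma Tdag_unit : exists w, w * (R_to_T (Ra * Rb * Rc) *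
  (R_to_T (Rb + Rc) ^+ 2 * (1 - R_to_T (Rb * Rc)))) = 1.
Proof.
have [k kabc] := Rabc_unit.
pose x' := S_to_T (Defs.frac Rx 1 1).
have xK : x' * R_to_T (Rb + Rc) = 1.
  by rewrite -[R_to_T _]/(S_to_T (to_loc Rx Rx)) -rmorphM frac1K rmorph1.
pose y' := Defs.frac Sdag_y1 1 1.
have yK : y' * (R_to_T (Rb * Rc) - 1) = 1.
  have -> : R_to_T (Rb * Rc) - 1 = to_loc Sdag_y1 Sdag_y1.
    by rewrite -(rmorph1 R_to_T) -rmorphB.
  exact: frac1K.
exists (R_to_T k * x' ^+ 2 * - y').
have {}kabc : R_to_T k * R_to_T (Ra * Rb * Rc) = 1 by rewrite -rmorphM kabc rmorph1.
move: xK yK kabc; set u := R_to_T (Rb + Rc); set v := R_to_T (Rb * Rc).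
set p := R_to_T k; set q := R_to_T _ => xK yK pq.
transitivity ((p * q) * (x' * u) ^+ 2 * (y' * (v - 1))); first by ring.
by rewrite xK yK pq expr1n !mulr1.
Qed.

Section LinearDifference.
Variables (M V : lmodType Rabc) (f : {linear V -> M}) (h : {linear V -> Sx}).
Variable m : ext_scalars R_to_T M.

Definition ext_diff u := tens R_to_T (f u) 1 - S_to_T (h u) *: m.

Lemma ext_diffD u v : ext_diff (u + v) = ext_diff u + ext_diff v.
Proof.
have tensD n n' : tens R_to_T (n + n') 1 = tens R_to_T n 1 + tens R_to_T n' 1
    :> ext_scalars R_to_T M.
  by rewrite -tsumD; apply/tsumP/tcong_Dl.
by rewrite /ext_diff !linearD tensD rmorphD scalerDl opprD addrACA.
Qed.

Lemma ext_diffZ r u : ext_diff (r *: u) = R_to_T r *: ext_diff u.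
Proof.
have hZ : h (r *: u) = to_loc Rx r * h u by exact: linearZ.
by rewrite /ext_diff hZ linearZ tens_balanced -tens_scale rmorphM scalerBr scalerA.
Qed.
End LinearDifference.

Theorem proposition5p7 (M : lmodType Rabc)
    (t : forall n : nat, {linear BMWabc n.+1 -> M})
    (tH : forall n : nat, {linear BMWabc n.+1 -> Sx}) :
  markov_trace t -> ocneanu_trace tH ->
  exists m : ext_scalars R_to_T M,
    forall (n : nat) (u : BMWabc n.+1),
      tens R_to_T (t n u) 1 = S_to_T (tH n u) *: m.
Proof.
move=> [tC tg] [[tHC tHg] _ tH1].
have [k kabc] := Rabc_unit; have [w wK] := Tdag_unit.
(* The only candidate, since t^H_1(1) = 1. *)
pose m := tens R_to_T (t 0 1) 1.
pose d n := ext_diff (t n) (tH n) m.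
exists m => n u; apply/eqP; rewrite -subr_eq0; apply/eqP.
apply: (@BMW_trace_eq0 _ Ra Rb Rc k Tdag R_to_T _ d w kabc _ _ _ _ Tdag_a2 wK).
- by move=> l; apply: ext_diffD.
- by move=> l; apply: ext_diffZ.
- by move=> l v v'; rewrite /d /ext_diff tC tHC.
- move=> l v; have [tg1 tg2] := tg l v; have [tHg1 tHg2] := tHg l v.
  by case; rewrite /d /ext_diff /sgen ?tg1 ?tg2 ?tHg1 ?tHg2.
by rewrite /d /ext_diff tH1 rmorph1 scale1r subrr.
Qed.
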